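(* The set of systems $f\in\mathrm{RDS}(I)$ whose unique stationary probability measure $\mu_f$ on $(0,1)$ is singular with respect to Lebesgue measure is dense in $(\mathrm{RDS}(I),d_m)$.
   Context: Let $I=[0,1]$. Define $h:(0,1)\to\mathbb{R}$ by $h(x)=\log(x)-\log(1/2)$ for $x\in(0,1/2]$ and $h(x)=\log(1/2)-\log(1-x)$ for $x\in[1/2,1)$, and put $d_h(x,y)=|h(x)-h(y)|$. Let $\mathrm{C}(I)$ be the set of continuous functions $f$ from $I$ onto $I$ such that $f(0)=0$, $f(1)=1$, $f((0,1))\subset(0,1)$, and the (one-sided) derivatives $f'(0),f'(1)$ exist and lie in $(0,\infty)$. It carries the metric $d_{\mathrm{C}(I)}(f,g)=\sup_{x\in(0,1)}d_h(f(x),g(x))$ (which is always finite). Let $\mathrm{RDS}(I)$ be the set of triples $f=(f_0,f_1,p_f)\in\mathrm{C}(I)\times\mathrm{C}(I)\times[0,1]$ such that: (i) $f_0,f_1$ are homeomorphisms; (ii) $f_0(x)<x$ for all $x\in(0,1)$; (iii) $f_1(x)>x$ for all $x\in(0,1)$; (iv) $p_f\in(0,1)$; (v) for $j\in\{0,1\}$, $\Lambda_j=p_f\log f_0'(j)+(1-p_f)\log f_1'(j)>0$. It carries the metric $d_m(f,g)=\max\{d_{\mathrm{C}(I)}(f_0,g_0),d_{\mathrm{C}(I)}(f_1,g_1),|p_f-p_g|\}$. A Borel probability measure $\mu$ on $(0,1)$ is stationary for $f\in\mathrm{RDS}(I)$ if $\mu(A)=p_f\,\mu(f_0^{-1}(A))+(1-p_f)\,\mu(f_1^{-1}(A))$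 for every Borel set $A\subset(0,1)$. It is a known fact that each $f\in\mathrm{RDS}(I)$ has exactly one stationary Borel probability measure on $(0,1)$, denoted $\mu_f$. A probability measure $\mu$ on $(0,1)$ is singular if there is a Borel set $A$ with $\mu(A)=1$ and Lebesgue measure zero. *)

(* Defs.v *)
From HB Require Import structures.
From mathcomp Require Import all_boot all_order all_algebra.
From mathcomp Require Import all_classical all_reals all_analysis.

Set Implicit Arguments.
Unset Strict Implicit.
Unset Printing Implicit Defensive.

Import Order.TTheory GRing.Theory Num.Theory.
Import numFieldNormedType.Exports.

Local Open Scope classical_set_scope.
Local Open Scope ring_scope.

Definition unitI (R : realType) : set R := `[0, 1]%classic.
Definition unitIo (R : realType) : set R := `]0, 1[%classic.

Definition hlog (R : realType) (x : R) : R :=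
  if x <= 2^-1 then ln x - ln 2^-1 else ln 2^-1 - ln (1 - x).

Definition dh (R : realType) (x y : R) : R := `|hlog x - hlog y|.

Definition right_slope (R : realType) (f : R -> R) (a : R) : set_system R :=
  (f x - f a) / (x - a) @[x --> a^'+].
Definition left_slope (R : realType) (f : R -> R) (a : R) : set_system R :=
  (f x - f a) / (x - a) @[x --> a^'-].

Definition derivI0 (R : realType) (f : R -> R) : R := lim (right_slope f 0).
Definition derivI1 (R : realType) (f : R -> R) : R := lim (left_slope f 1).

(* A self-map of [0, 1] is represented by a function R -> R whose values
   outside [0, 1] are arbitrary and never used. *)
Record isCI (R : realType) (f : R -> R) : Prop := IsCI {
  CI_continuous : {within @unitI R, continuous f};
  CI_onto : f @` @unitI R = @unitI R;
  CI_0 : f 0 = 0;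
  CI_1 : f 1 = 1;
  CI_interior : f @` @unitIo R `<=` @unitIo R;
  CI_cvg0 : cvg (right_slope f 0);
  CI_deriv0_gt0 : 0 < derivI0 f;
  CI_cvg1 : cvg (left_slope f 1);
  CI_deriv1_gt0 : 0 < derivI1 f
}.

Definition homeoI (R : realType) (f : R -> R) : Prop :=
  exists g : R -> R,
    [/\ {within @unitI R, continuous f} /\ {within @unitI R, continuous g},
        f @` @unitI R `<=` @unitI R /\ g @` @unitI R `<=` @unitI R,
        (forall x, @unitI R x -> g (f x) = x)
      & (forall x, @unitI R x -> f (g x) = x)].

Definition Lambda0 (R : realType) (f0 f1 : R -> R) (p : R) : R :=
  p * ln (derivI0 f0) + (1 - p) * ln (derivI0 f1).
Definition Lambda1 (R : realType) (f0 f1 : R -> R) (p : R) : R :=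
  p * ln (derivI1 f0) + (1 - p) * ln (derivI1 f1).

Record RDS (R : realType) : Type := MkRDS {
  map0 : R -> R;
  map1 : R -> R;
  weight : R;
  map0_CI : isCI map0;
  map1_CI : isCI map1;
  map0_homeo : homeoI map0;
  map1_homeo : homeoI map1;
  map0_lt : forall x, @unitIo R x -> map0 x < x;
  map1_gt : forall x, @unitIo R x -> x < map1 x;
  weight_in : 0 < weight < 1;
  Lambda0_gt0 : 0 < Lambda0 map0 map1 weight;
  Lambda1_gt0 : 0 < Lambda1 map0 map1 weight
}.

(* The suprema are taken in the extended reals, so that no finiteness proof is
   needed to define the distances. *)
Definition dCI (R : realType) (f g : R -> R) : \bar R :=
  ereal_sup [set (dh (f x) (g x))%:E | x in @unitIo R].

Definition dm (R : realType) (f g : RDS R) : \bar R :=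
  maxe (maxe (dCI (map0 f) (map0 g)) (dCI (map1 f) (map1 g)))
       (`|weight f - weight g|)%:E.

Section dm_theory.
Context {R : realType}.
Local Open Scope ereal_scope.

Lemma dCI_ge0 (f g : R -> R) : 0 <= dCI f g.
Proof.
apply: le_ereal_sup_tmp; exists (dh (f 2^-1) (g 2^-1))%:E.
  exists 2^-1%R => //; rewrite /unitIo /= in_itv /=.
  by rewrite invr_gt0 ltr0n invf_lt1 ?ltr1n.
by rewrite lee_fin normr_ge0.
Qed.

Lemma dCIxx (f : R -> R) : dCI f f = 0.
Proof.
apply/eqP; rewrite eq_le dCI_ge0 andbT; apply: ge_ereal_sup => _ [x _ <-].
by rewrite /dh subrr normr0.
Qed.

Lemma dCI_sym (f g : R -> R) : dCI f g = dCI g f.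
Proof.
by rewrite /dCI; congr ereal_sup; apply: eq_imagel => x _; rewrite /dh distrC.
Qed.

Lemma dCI_triangle (g f k : R -> R) : dCI f k <= dCI f g + dCI g k.
Proof.
apply: ge_ereal_sup => _ [x xI <-].
apply: (@le_trans _ _ ((dh (f x) (g x))%:E + (dh (g x) (k x))%:E)).
  by rewrite -EFinD lee_fin /dh ler_distD.
by apply: leeD; apply: ereal_sup_ubound; exists x.
Qed.

Lemma dm_ge0 (f g : RDS R) : 0 <= dm f g.
Proof. by rewrite /dm le_max lee_fin normr_ge0 orbT. Qed.

Lemma dmxx (f : RDS R) : dm f f = 0.
Proof. by rewrite /dm !dCIxx subrr normr0 !maxxx. Qed.

Lemma dm_sym (f g : RDS R) : dm f g = dm g f.
Proof.
by rewrite /dm (dCI_sym (map0 f)) (dCI_sym (map1 f)) distrC.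
Qed.

Lemma dm_triangle (g f k : RDS R) : dm f k <= dm f g + dm g k.
Proof.
rewrite {1}/dm !ge_max -andbA; apply/and3P; split.
- apply: le_trans (dCI_triangle (map0 g) _ _) _.
  by apply: leeD; rewrite /dm !le_max lexx.
- apply: le_trans (dCI_triangle (map1 g) _ _) _.
  by apply: leeD; rewrite /dm !le_max lexx !orbT.
- apply: (@le_trans _ _ ((`|weight f - weight g|)%:E
                          + (`|weight g - weight k|)%:E)).
    by rewrite -EFinD lee_fin ler_distD.
  by apply: leeD; rewrite /dm !le_max lexx !orbT.
Qed.

End dm_theory.

Definition dm_ball (R : realType) (f : RDS R) (e : R) : set (RDS R) :=
  [set g | (dm f g < e%:E)%E].

Section RDS_pseudoMetric.
Context (R : realType).

Let ball_center (f : RDS R) (e : R) : 0 < e -> dm_ball f e f.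
Proof. by move=> e0; rewrite /dm_ball /= dmxx lte_fin. Qed.

Let ball_sym (f g : RDS R) (e : R) : dm_ball f e g -> dm_ball g e f.
Proof. by rewrite /dm_ball /= dm_sym. Qed.

Let ball_triangle (f g k : RDS R) (e1 e2 : R) :
  dm_ball f e1 g -> dm_ball g e2 k -> dm_ball f (e1 + e2) k.
Proof.
rewrite /dm_ball /= => fg gk; apply: le_lt_trans (dm_triangle g f k) _.
by rewrite EFinD; apply: lteD.
Qed.

HB.instance Definition _ := gen_eqMixin (RDS R).
HB.instance Definition _ := gen_choiceMixin (RDS R).
HB.instance Definition _ :=
  hasNbhs.Build (RDS R) (nbhs_ (entourage_ (@dm_ball R))).
(* The topology of d_m; two systems that agree on [0, 1] are at distance 0. *)
HB.instance Definition _ := @Nbhs_isPseudoMetric.Build R (RDS R)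
  (entourage_ (@dm_ball R)) erefl (@dm_ball R)
  ball_center ball_sym ball_triangle erefl.

End RDS_pseudoMetric.

(* A Borel probability measure on (0, 1) is a Borel probability measure on R
   giving full mass to (0, 1). *)
Definition stationary (R : realType) (f : RDS R)
    (mu : probability (measurableTypeR R) R) : Prop :=
  mu (@unitIo R) = 1%E /\
  forall A : set (measurableTypeR R), measurable A -> A `<=` @unitIo R ->
    mu A = ((weight f)%:E * mu (@unitI R `&` map0 f @^-1` A)
            + (1 - weight f)%:E * mu (@unitI R `&` map1 f @^-1` A))%E.

(* Equality of measures is equality on Borel sets: the values of a measure on
   non-measurable sets are unconstrained. *)
Definition unique_stationary (R : realType) (f : RDS R)
    (mu : probability (measurableTypeR R) R) : Prop :=
  stationary f mu /\
  forall nu : probability (measurableTypeR R) R, stationary f nu ->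
    forall A : set (measurableTypeR R), measurable A -> nu A = mu A.

Definition singular_measure (R : realType)
    (mu : probability (measurableTypeR R) R) : Prop :=
  exists A : set (measurableTypeR R),
    [/\ measurable A, A `<=` @unitIo R, mu A = 1%E
      & @lebesgue_measure R A = 0%E].

(* Main.v *)
Require Import Defs.
From HB Require Import structures.
From mathcomp Require Import all_boot all_order all_algebra.
From mathcomp Require Import all_classical all_reals all_analysis.
From mathcomp Require Import measurable_realfun zify ring lra.

Import Order.TTheory GRing.Theory Num.Theory.
Import numFieldNormedType.Exports.
Local Open Scope classical_set_scope.
Local Open Scope ring_scope.

Set Implicit Arguments.
Unset Strict Implicit.
Unset Printing Implicit Defensive.

(** Conjugating a system by a homeomorphism [h] of the interval pushes its
    stationary measure forward by [h].  It therefore suffices to find [h] close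
    to the identity, with derivative 1 at both endpoints, that maps a set of full
    measure for the given stationary measure [mu] onto a Lebesgue null set.

    In the coordinate [hlog] the interval becomes the line and derivatives at the
    endpoints become limits of displacements [f u - u].  The map [h] preserves
    every cell [chi^-1([k, k+1[)], [k] an integer, where
    [chi u = u^3 + M (u + f0 u + f1 u)] is increasing: the term with [M] makes
    [h] and [f_j o h] uniformly close to the identity and to [f_j], and the
    cubic term makes the displacement of
    [h] vanish at both ends.  Inside a cell, [h] is built by repeated bisection,
    the half of larger [mu]-mass always getting a fifth of the Lebesgue mass; the
    Hellinger affinity of the two measures then decays geometrically along the
    bisections, so they are mutually singular by Borel-Cantelli.

    The distribution function [F] of a stationary measure solves
    [F = p F o f0^-1 + (1 - p) F o f1^-1].  Positivity of the Lyapunov exponents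
    provides ordered super- and subsolutions, between which monotone iteration
    yields a solution; a maximum principle gives uniqueness. *)

(** * Increasing homeomorphisms of the line *)

Section increasing_bijections.
Context {R : realType}.
Implicit Types f g : R -> R.

(** Carrying the inverse along makes composition and conjugation immediate; continuity and
    measurability come for free from monotonicity and surjectivity. *)
Definition incbij f g := [/\ {homo f : x y / x < y}, cancel f g & cancel g f].

Lemma incbij_mono_le f g : incbij f g -> {mono f : x y / x <= y}.
Proof. by case=> fh _ _; apply: le_mono. Qed.

Lemma incbij_mono_lt f g : incbij f g -> {mono f : x y / x < y}.
Proof. by move=> /incbij_mono_le/leW_mono. Qed.

Lemma incbij_sym f g : incbij f g -> incbij g f.
Proof.
move=> fg; have fm := incbij_mono_lt fg; case: fg => fh fK gK.
by split=> // x y xy; rewrite -fm !gK.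
Qed.

Lemma incbij_comp f f' g g' :
  incbij f f' -> incbij g g' -> incbij (f \o g) (g' \o f').
Proof.
move=> [fh fK f'K] [gh gK g'K]; split=> [x y xy|x|x] /=.
- exact/fh/gh.
- by rewrite fK gK.
- by rewrite g'K f'K.
Qed.

Lemma increasing_surj_continuous f : {homo f : x y / x < y} ->
  (forall y, exists x, f x = y) -> continuous f.
Proof.
move=> fh fs x.
have fm : {mono f : x y / x <= y} by apply: le_mono.
have lt1 : x - 1 < x + 1 by lra.
have : {within `[x - 1, x + 1], continuous f}.
  apply: segment_inc_surj_continuous.
    by move=> a b _ _; rewrite fm.
  move=> y /=; rewrite in_itv /= => yI.
  have [z zy] := fs y; exists z => //=.
  by move: yI; rewrite -zy !fm in_itv.
move=> /continuous_within_itvP => /(_ lt1)[+ _ _].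
by apply; rewrite in_itv /=; lra.
Qed.

Lemma incbij_continuous f g : incbij f g -> continuous f.
Proof.
by case=> fh _ gK; apply: increasing_surj_continuous => // y; exists (g y).
Qed.

Lemma incbij_measurable f g : incbij f g -> measurable_fun setT f.
Proof.
move=> fg; apply: nondecreasing_measurable => // x y.
by rewrite (incbij_mono_le fg).
Qed.

Lemma incbij_of_surj f : {homo f : x y / x < y} ->
  (forall y, exists x, f x = y) -> exists g, incbij f g.
Proof.
move=> fh fs; have [g gP] := choice fs; exists g; split => // x.
have fm : {mono f : x y / x <= y} by apply: le_mono.
by apply: (inc_inj fm); rewrite gP.
Qed.

(** [l] and [r] are the limits of [f u - u] at [-oo] and [+oo], with one threshold [K] serving both
    ends. For a map of the interval read in the coordinate [hlog] they are the logarithm of the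
    derivative at 0 and minus the logarithm of the derivative at 1. *)
Definition disp f (l r : R) := forall e, 0 < e -> exists K, forall u,
  (u < - K -> `|f u - u - l| < e) /\ (K < u -> `|f u - u - r| < e).

Lemma disp_comp f g l r l' r' : disp f l r -> disp g l' r' ->
  disp (f \o g) (l + l') (r + r').
Proof.
move=> df dg e e0; have e2 : 0 < e / 2 by lra.
have [K HK] := df _ e2; have [K' HK'] := dg _ e2.
(* Far enough out that [g u], which differs from [u] by less than [|l'| + e] or [|r'| + e], is still
   beyond the threshold [K] of [f]. *)
exists (`|K| + `|K'| + `|l'| + `|r'| + e) => u /=.
have [a1 b1] := HK' u; have [a2 b2] := HK (g u).
have := ler_norm K; have := ler_norm K'; have := ler_norm l'.
have := ler_norm r'; have := ler_norm (- l'); have := ler_norm (- r').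
rewrite !normrN.
have := normr_ge0 K; have := normr_ge0 K'; have := normr_ge0 l'.
have := normr_ge0 r'.
move=> *; split=> hu.
- have {}a1 : `|g u - u - l'| < e / 2 by apply: a1; lra.
  move: a1; rewrite ltr_norml => /andP[? ?].
  have {}a2 : `|f (g u) - g u - l| < e / 2 by apply: a2; lra.
  by move: a2; rewrite !ltr_norml => /andP[? ?]; lra.
- have {}b1 : `|g u - u - r'| < e / 2 by apply: b1; lra.
  move: b1; rewrite ltr_norml => /andP[? ?].
  have {}b2 : `|f (g u) - g u - r| < e / 2 by apply: b2; lra.
  by move: b2; rewrite !ltr_norml => /andP[? ?]; lra.
Qed.

Lemma disp_inv f g l r : incbij f g -> disp f l r -> disp g (- l) (- r).
Proof.
move=> fg df e e0; have [K HK] := df _ e0.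
have [fh fK gK] := fg; have gm := incbij_mono_lt (incbij_sym fg).
exists (`|f (- K)| + `|f K|) => u.
have := ler_norm (f K); have := ler_norm (- f (-K)).
have := normr_ge0 (f K); have := normr_ge0 (f (- K)).
rewrite normrN => *; split=> hu.
- have : g u < - K by rewrite -(fK (- K)) gm; lra.
  by move=> /(HK _).1; rewrite gK !ltr_norml => /andP[? ?]; lra.
- have : K < g u by rewrite -(fK K) gm; lra.
  by move=> /(HK _).2; rewrite gK !ltr_norml => /andP[? ?]; lra.
Qed.

(** This is why a conjugacy with vanishing displacement changes neither endpoint derivatives nor
    Lyapunov exponents. *)
Lemma disp_conj h h' f l r : incbij h h' -> disp h 0 0 -> disp f l r ->
  disp (h \o f \o h') l r.
Proof.
move=> hh' dh0 df; have dh' := disp_inv hh' dh0.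
have := disp_comp (disp_comp dh0 df) dh'.
by rewrite oppr0 !addr0 !add0r.
Qed.

End increasing_bijections.

(** * Borel measures on the line and their distribution functions *)

Section borel_measures.
Context {R : realType}.
Local Notation RT := (measurableTypeR R).

Lemma prob_of_cdf (F : R -> R) : {homo F : x y / x <= y} ->
  (forall x, F y @[y --> x^'+] --> F x) ->
  F x @[x --> -oo] --> (0 : R) -> F x @[x --> +oo] --> (1 : R) ->
  exists mu : probability RT R, forall x, mu `]-oo, x]%classic = (F x)%:E.
Proof.
move=> Fnd Fusc FN Fy.
pose m1 := isCumulative.Build R _ R F Fnd Fusc.
pose m2 := isCumulativeBounded.Build R 0 1 F FN Fy.
pose F' : cumulativeBounded (0 : R) (1 : R) := HB.pack F m1 m2.
exists (lebesgue_stieltjes_measure F') => x.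
exact: (cdf_lebesgue_stieltjes_id F' x).
Qed.

(** The intervals []a, b]] form a generating class closed under intersection, and their measures are
    differences of measures of half-lines; finiteness makes the subtraction legitimate. *)
Lemma finite_measure_eq (mu nu : {measure set RT -> \bar R}) :
  (mu setT < +oo)%E ->
  (forall x, mu `]-oo, x]%classic = nu `]-oo, x]%classic) ->
  forall A, measurable A -> mu A = nu A.
Proof.
move=> muoo munu A mA.
have fin (m : {measure set RT -> \bar R}) x :
    (m `]-oo, x]%classic <= m setT)%E by apply: le_measure; rewrite ?inE.
apply: (@measure_unique _ _ RT (@ocitv R) (fun n => `]-n%:R, n%:R]%classic)) => //.
- exact: ocitvI.
- by move=> i; exact: is_ocitv.
- exact: (@bigcup_itvT R false false).
- move=> B /ocitvP[->|[[a b] /= ab ->]]; first by rewrite !measure0.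
  have E (m : {measure set RT -> \bar R}) :
      (m `]-oo, b]%classic = m `]-oo, a]%classic + m `]a, b]%classic)%E.
    rewrite -measureU//.
      congr (m _); apply/seteqP; split => x /=; rewrite !in_itv /=; lra.
    by apply/seteqP; split => x //=; rewrite !in_itv /= => -[]; lra.
  have fi : mu `]-oo, a]%classic \is a fin_num.
    by rewrite ge0_fin_numE//; apply: le_lt_trans muoo; exact: fin.
  have := E mu; rewrite munu (E nu) -munu => /(congr1 (fun z => z - mu `]-oo, a]%classic)%E).
  by rewrite ![(mu `]-oo, a]%classic + _)%E]addeC !addeK.
- by move=> k; apply: le_lt_trans muoo; apply: le_measure; rewrite ?inE.
Qed.

Lemma prob_pushforward (mu : probability RT R) (f : R -> R) :
  measurable_fun setT f ->
  exists nu : probability RT R, forall A, nu A = mu (f @^-1` A).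
Proof.
move=> mf; pose m := isMeasurableFun.Build _ _ RT RT f mf.
pose X : {mfun RT >-> RT} := HB.pack f m.
by exists (distribution mu X).
Qed.

End borel_measures.

(** * Stationary measures on the line *)

Section stationary_measures_on_the_line.
Context {R : realType}.
Local Notation RT := (measurableTypeR R).
Implicit Types (f g : R -> R) (mu nu : probability RT R).

Definition statR f0 f1 (p : R) mu := forall A, measurable A ->
  (mu A = p%:E * mu (f0 @^-1` A) + (1 - p)%:E * mu (f1 @^-1` A))%E.

Definition cdfR mu (x : R) : R := fine (mu `]-oo, x]%classic).

Lemma cdfRE mu x : mu `]-oo, x]%classic = (cdfR mu x)%:E.
Proof. by rewrite /cdfR fineK// fin_num_measure. Qed.

Lemma cdfR_ge0 mu x : 0 <= cdfR mu x.
Proof. by rewrite fine_ge0. Qed.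

Lemma cdfR_le1 mu x : cdfR mu x <= 1.
Proof. by rewrite -lee_fin -cdfRE probability_le1. Qed.

Lemma cdfR_tail mu e : 0 < e -> exists K, forall x,
  (x < - K -> cdfR mu x < e) /\ (K < x -> 1 - e < cdfR mu x).
Proof.
move=> e0; pose m := isMeasurableFun.Build _ _ RT R idfun (@measurable_id _ RT setT).
pose X : {RV mu >-> R} := HB.pack (idfun : RT -> R) m.
have l0 : cdfR mu x @[x --> -oo] --> (0 : R) by exact: fine_cvg (cvg_cdfNy0 X).
have l1 : cdfR mu x @[x --> +oo] --> (1 : R) by exact: fine_cvg (cvg_cdfy1 X).
have /cvgrPdist_lt/(_ _ e0)[a [_ Ha]] := l0.
have /cvgrPdist_lt/(_ _ e0)[b [_ Hb]] := l1.
exists (`|a| + `|b|) => x.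
have := ler_norm b; have := ler_norm (- a); rewrite normrN.
have := normr_ge0 a; have := normr_ge0 b => *; split => hx.
- have /Ha : x < a by lra.
  by rewrite /= sub0r normrN; apply: le_lt_trans; exact: ler_norm.
- have /Hb : b < x by lra.
  by rewrite /= => /(le_lt_trans (ler_norm _)); rewrite -/(cdfR mu x); lra.
Qed.

Lemma preimage_incbij f g x : incbij f g ->
  f @^-1` `]-oo, x]%classic = `]-oo, g x]%classic.
Proof.
move=> fg; have fm := incbij_mono_le fg; case: fg => _ _ gK.
have E y : (f y <= x) = (y <= g x) by rewrite -{1}[x]gK fm.
by apply/seteqP; split => y /=; rewrite !in_itv /= E.
Qed.

Lemma statR_cdf f0 g0 f1 g1 p mu : incbij f0 g0 -> incbij f1 g1 ->
  statR f0 f1 p mu ->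
  forall x, cdfR mu x = p * cdfR mu (g0 x) + (1 - p) * cdfR mu (g1 x).
Proof.
move=> fg0 fg1 st x; have := st _ (measurable_itv `]-oo, x]).
rewrite (preimage_incbij _ fg0) (preimage_incbij _ fg1) !cdfRE.
by rewrite -!EFinM -EFinD => -[].
Qed.

(** The right-hand side of the stationarity equation is itself a measure in [A], so it suffices to
    compare it with [mu] on half-lines. *)
Lemma cdf_statR f0 g0 f1 g1 p mu : incbij f0 g0 -> incbij f1 g1 -> 0 < p < 1 ->
  (forall x, cdfR mu x = p * cdfR mu (g0 x) + (1 - p) * cdfR mu (g1 x)) ->
  statR f0 f1 p mu.
Proof.
move=> fg0 fg1 /andP[p0 p1] H.
have p0' : 0 <= p by lra.
have q0' : 0 <= 1 - p by lra.
have [nu0 nu0E] := prob_pushforward mu (incbij_measurable fg0).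
have [nu1 nu1E] := prob_pushforward mu (incbij_measurable fg1).
pose m : {measure set RT -> \bar R} :=
  measure_add (mscale (NngNum p0') nu0) (mscale (NngNum q0') nu1).
have mE A : (m A = p%:E * mu (f0 @^-1` A) + (1 - p)%:E * mu (f1 @^-1` A))%E.
  have := measure_addE (mscale (NngNum p0') nu0) (mscale (NngNum q0') nu1) A.
  by rewrite -nu0E -nu1E; apply: etrans.
move=> A mA; rewrite -mE; apply: finite_measure_eq => //.
  by rewrite (le_lt_trans (probability_le1 mu measurableT)) ?ltry.
move=> x; rewrite mE (preimage_incbij _ fg0) (preimage_incbij _ fg1) !cdfRE.
by rewrite -!EFinM -EFinD -H; exact: cdfRE.
Qed.

(** A bounded orbit would have a supremum [s] with [g s < s]; some point of the orbit would exceed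
    [g s], and its image under [f] would exceed [s]. *)
Lemma iter_escape f g : incbij f g -> (forall x, x < f x) ->
  forall a b : R, exists n, b < iter n f a.
Proof.
move=> fg fx a b; apply: contrapT => H.
have Hb n : iter n f a <= b.
  by rewrite leNgt; apply/negP => ?; apply: H; exists n.
pose S := range (fun n => iter n f a).
have supS : has_sup S.
  by split; [exists a, 0%N|exists b => _ [n _ <-]].
have gm := incbij_mono_lt (incbij_sym fg); have fm := incbij_mono_lt fg.
have [fh fK gK] := fg.
have gL : g (sup S) < sup S by rewrite -{2}[sup S]gK fx.
have [_ [n _ <-] /=] := sup_adherent (eps := sup S - g (sup S)) (ltac:(lra)) supS.
rewrite opprB addrC subrK -fm gK => L1.
have : iter n.+1 f a <= sup S by apply: ub_le_sup => //; [case: supS|exists n.+1].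
by rewrite /= leNgt L1.
Qed.

(* Maximum principle: a bounded function [D] with [D = p D∘g0 + (1-p) D∘g1]
   that vanishes at both ends cannot have a positive supremum, since the orbits
   of [g0] escape to [+oo]. *)
Lemma statR_cdf_le f0 g0 f1 g1 p mu nu : incbij f0 g0 -> incbij f1 g1 ->
  0 < p < 1 -> (forall x, f0 x < x) ->
  statR f0 f1 p mu -> statR f0 f1 p nu -> forall x, cdfR mu x <= cdfR nu x.
Proof.
move=> fg0 fg1 /andP[p0 p1] f0x smu snu x0; rewrite leNgt; apply/negP => x0P.
pose D x := cdfR mu x - cdfR nu x.
have DE x : D x = p * D (g0 x) + (1 - p) * D (g1 x).
  rewrite /D (statR_cdf fg0 fg1 smu x) (statR_cdf fg0 fg1 snu x); ring.
have D1 x : D x <= 1.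
  by have := cdfR_le1 mu x; have := cdfR_ge0 nu x; rewrite /D; lra.
have supD : has_sup (range D).
  by split; [exists (D x0), x0|exists 1 => _ [x _ <-]].
set M := sup (range D).
have DM x : D x <= M by apply: ub_le_sup; [case: supD|exists x].
have M0 : 0 < M by apply: lt_le_trans (DM x0); rewrite /D; lra.
have M2 : 0 < M / 4 by lra.
have [K HK] := cdfR_tail mu M2; have [K' HK'] := cdfR_tail nu M2.
pose L := `|K| + `|K'| + 1.
have LK : K < L /\ K' < L.
  by have := ler_norm K; have := ler_norm K'; have := normr_ge0 K;
    have := normr_ge0 K'; rewrite /L; lra.
have Dl x : x < - L -> D x <= M / 2.
  move=> xL; have /(HK x).1 ? : x < - K by lra.
  by have := cdfR_ge0 nu x; rewrite /D; lra.
have Dr x : L < x -> D x <= M / 2.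
  move=> xL; have /(HK' x).2 ? : K' < x by lra.
  by have := cdfR_le1 mu x; rewrite /D; lra.
have g0x x : x < g0 x.
  by have [_ _ gK] := fg0; have := f0x (g0 x); rewrite gK.
have [n Hn] := iter_escape (incbij_sym fg0) g0x (- L) L.
have gm := incbij_mono_le (incbij_sym fg0).
have Hn' x : - L <= x -> L < iter n g0 x.
  move=> xL; apply: lt_le_trans Hn _; elim: (n) => //= k IH.
  by rewrite gm.
have Dn k x : D x <= p ^+ k * D (iter k g0 x) + (1 - p ^+ k) * M.
  elim: k x => [|k IH] x; first by rewrite /= expr0; lra.
  rewrite iterSr DE; have := IH (g0 x); rewrite exprS.
  have := DM (g1 x); set a := D (g1 x); set b := D (g0 x).
  set c := D (iter _ _ _); set q := p ^+ k => h1 h2.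
  have : p * b <= p * (q * c + (1 - q) * M) by rewrite ler_pM2l.
  have : (1 - p) * a <= (1 - p) * M by rewrite ler_pM2l //; lra.
  lra.
have pn0 : 0 < p ^+ n by rewrite exprn_gt0.
have pn1 : p ^+ n <= 1 by rewrite exprn_ile1 //; lra.
have Mb : 0 < M * p ^+ n by rewrite mulr_gt0.
have Ma : M * p ^+ n <= M * 1 by rewrite ler_pM2l.
(* The number [n] of steps is uniform in [x]: to the left of [- L] the bound [M / 2] holds at once,
   and from anywhere else [n] steps of [g0] lead beyond [L], where it holds too. *)
have : M <= M * (1 - p ^+ n / 2).
  apply: ge_sup; first by case: supD.
  move=> _ [x _ <-]; have [xL|xL] := leP (- L) x; last first.
    by have := Dl x xL; lra.
  have /Dr h := Hn' x xL; have := Dn n x.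
  have : p ^+ n * D (iter n g0 x) <= p ^+ n * (M / 2) by rewrite ler_pM2l.
  lra.
by lra.
Qed.

Lemma statR_unique f0 g0 f1 g1 p mu nu : incbij f0 g0 -> incbij f1 g1 ->
  0 < p < 1 -> (forall x, f0 x < x) ->
  statR f0 f1 p mu -> statR f0 f1 p nu -> forall A, measurable A -> mu A = nu A.
Proof.
move=> fg0 fg1 pI f0x smu snu; apply: finite_measure_eq.
  by rewrite (le_lt_trans (probability_le1 mu measurableT)) ?ltry.
move=> x; apply: etrans (cdfRE mu x) _; apply: etrans _ (esym (cdfRE nu x)).
congr (_%:E); apply/eqP; rewrite eq_le.
by rewrite (statR_cdf_le fg0 fg1 pI f0x smu snu) (statR_cdf_le fg0 fg1 pI f0x snu smu).
Qed.

End stationary_measures_on_the_line.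

(** * Existence of stationary measures by monotone iteration between barriers *)

Section existence_of_stationary_measures.
Context {R : realType}.
Local Notation RT := (measurableTypeR R).
Implicit Types (f g F H : R -> R).

(** With the decay [C / |u|], a bounded shift of [u] changes the value to first order in proportion
    to the shift, so that averaging over two shifts sees only the mean drift. *)
Definition barrier (C u : R) : R := if u < - C then C / - u else 1.

Lemma barrier_bound C z w : 0 < C -> z <= w -> w < 0 -> barrier C z <= C / - w.
Proof.
move=> C0 zw w0; rewrite /barrier; case: ltP => zC.
  by rewrite ler_pM2l // lef_pV2 ?posrE; lra.
by rewrite ler_pdivlMr; lra.
Qed.

Lemma barrier_le1 C u : 0 < C -> barrier C u <= 1.
Proof.
by move=> C0; rewrite /barrier; case: ltP => // uC; rewrite ler_pdivrMr; lra.
Qed.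

Lemma barrier_ge0 C u : 0 < C -> 0 <= barrier C u.
Proof.
move=> C0; rewrite /barrier; case: ltP => // uC.
by rewrite divr_ge0 //; lra.
Qed.

Lemma barrier_nd C : 0 < C -> {homo barrier C : u w / u <= w}.
Proof.
move=> C0 u w uw; rewrite {2}/barrier; case: ltP => wC.
  by apply: barrier_bound => //; lra.
exact: barrier_le1.
Qed.

(** Where the barrier equals 1 there is nothing to prove. For [u < - C], over a common denominator
    the difference of the two sides has the sign of [b0 * b1 + (- u) * m], where [m] is minus the
    mean drift; this is nonnegative once [- u] exceeds [q]. The maps [k0], [k1] are arbitrary so
    that the result also applies to the system reflected in 0. *)
Lemma barrier_super (p b0 b1 K : R) : 0 < p < 1 -> p * b0 + (1 - p) * b1 < 0 ->
  exists C0, forall C, C0 <= C -> forall k0 k1 : R -> R,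
  (forall u, u < - K -> k0 u <= u + b0 /\ k1 u <= u + b1) ->
  forall u, p * barrier C (k0 u) + (1 - p) * barrier C (k1 u) <= barrier C u.
Proof.
move=> /andP[p0 p1] m0; pose m := - (p * b0 + (1 - p) * b1).
have {}m0 : 0 < m by rewrite /m; lra.
pose q := `|b0 * b1| / m.
have q0 : 0 <= q by rewrite divr_ge0 // ltW.
exists (`|K| + `|b0| + `|b1| + q + 1) => C CC k0 k1 Hk u.
have := ler_norm K; have := ler_norm b0; have := ler_norm b1.
have := normr_ge0 K; have := normr_ge0 b0; have := normr_ge0 b1.
move=> *; have C0 : 0 < C by lra.
rewrite {3}/barrier; case: ltP => uC; last first.
  have := barrier_le1 (k0 u) C0; have := barrier_le1 (k1 u) C0.
  set a := barrier _ _; set b := barrier _ _ => ha hb.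
  have : p * b <= p * 1 by rewrite ler_pM2l.
  have : (1 - p) * a <= (1 - p) * 1 by rewrite ler_pM2l //; lra.
  lra.
have [h0 h1] : k0 u <= u + b0 /\ k1 u <= u + b1 by apply: Hk; lra.
have {}h0 := barrier_bound C0 h0 (ltac:(lra)).
have {}h1 := barrier_bound C0 h1 (ltac:(lra)).
have e0 : p * barrier C (k0 u) <= p * (C / - (u + b0)) by rewrite ler_pM2l.
have e1 : (1 - p) * barrier C (k1 u) <= (1 - p) * (C / - (u + b1)).
  by rewrite ler_pM2l //; lra.
apply: le_trans (lerD e0 e1) _; rewrite -subr_ge0.
have -> : C / - u - (p * (C / - (u + b0)) + (1 - p) * (C / - (u + b1)))
  = C * (b0 * b1 + (- u) * m) / (- u * (- (u + b0)) * (- (u + b1))).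
  by rewrite /m; field; rewrite ?oppr_eq0; apply/and3P; split; lra.
have qu : q * m <= (- u) * m by rewrite ler_pM2r //; lra.
have qE : q * m = `|b0 * b1| by rewrite /q divfK //; lra.
have := ler_norm (- (b0 * b1)); rewrite normrN => *.
by rewrite divr_ge0 // ?mulr_ge0 //; lra.
Qed.

(** For a nondecreasing [F] this is right continuity, in a form that passes directly to infima of
    decreasing sequences. *)
Definition right_usc F := forall x e, 0 < e -> exists2 y, x < y & F y < F x + e.

Lemma barrier_right_usc C : 0 < C -> right_usc (barrier C).
Proof.
move=> C0 x e e0; have [xC|xC] := ltP x (- C); last first.
  exists (x + 1); first lra.
  have -> : barrier C x = 1 by rewrite /barrier ltNge xC.
  by have := barrier_le1 (x + 1) C0; lra.
pose t := C / - x + e / 2.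
have t0 : 0 < C / - x by rewrite divr_gt0 //; lra.
have tt : 0 < t by rewrite /t; lra.
(* The point where the hyperbola [C / - u] takes the value [t], which lies strictly between its
   value at [x] and that value plus [e]. *)
exists (- (C / t)).
  have : C / t < - x; last lra.
  by rewrite ltr_pdivrMr // mulrC -ltr_pdivrMr /t; lra.
have w0 : - (C / t) < 0 by rewrite oppr_lt0 divr_gt0.
have := barrier_bound C0 (lexx _) w0; rewrite opprK.
have -> : C / (C / t) = t by field; rewrite !gt_eqF.
have -> : barrier C x = C / - x by rewrite /barrier xC.
by rewrite /t; lra.
Qed.

Lemma right_usc_cvg F : {homo F : x y / x <= y} -> right_usc F ->
  forall x, F y @[y --> x^'+] --> F x.
Proof.
move=> Fnd Fusc x; apply/cvgrPdist_lt => e e0.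
have [y xy Fy] := Fusc x e e0.
near=> z; have xz : x < z by near: z; exact: nbhs_right_gt.
have zy : z < y by near: z; exact: nbhs_right_lt.
have := Fnd _ _ (ltW xz); have := Fnd _ _ (ltW zy).
by rewrite ltr_norml; lra.
Unshelve. all: by end_near. Qed.

Section transfer.
Variables (f0 g0 f1 g1 : R -> R) (p : R).
Hypotheses (fg0 : incbij f0 g0) (fg1 : incbij f1 g1) (pI : 0 < p < 1).

Definition transfer H (x : R) : R := p * H (g0 x) + (1 - p) * H (g1 x).

Let p0 : 0 < p. Proof. by case/andP: pI. Qed.
Let q0 : 0 < 1 - p. Proof. by case/andP: pI => *; lra. Qed.

Lemma transfer_le H H' : (forall x, H x <= H' x) ->
  forall x, transfer H x <= transfer H' x.
Proof. by move=> HH x; rewrite lerD // ler_pM2l. Qed.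

Lemma transfer_nd H : {homo H : x y / x <= y} ->
  {homo transfer H : x y / x <= y}.
Proof.
move=> Hnd x y xy; rewrite lerD // ler_pM2l // Hnd //.
  by rewrite (incbij_mono_le (incbij_sym fg0)).
by rewrite (incbij_mono_le (incbij_sym fg1)).
Qed.

Lemma transfer_right_usc H : {homo H : x y / x <= y} -> right_usc H ->
  right_usc (transfer H).
Proof.
move=> Hnd Husc x e e0.
have [y0 xy0 Hy0] := Husc (g0 x) e e0.
have [y1 xy1 Hy1] := Husc (g1 x) e e0.
have m0 := incbij_mono_lt fg0; have m1 := incbij_mono_lt fg1.
have n0 := incbij_mono_le fg0; have n1 := incbij_mono_le fg1.
have [_ _ gK0] := fg0; have [_ _ gK1] := fg1.
exists (Num.min (f0 y0) (f1 y1)).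
  by rewrite lt_min -{1}[x]gK0 m0 xy0 -[x]gK1 m1.
have h0 : H (g0 (Num.min (f0 y0) (f1 y1))) <= H y0.
  by apply: Hnd; rewrite -n0 gK0 ge_min lexx.
have h1 : H (g1 (Num.min (f0 y0) (f1 y1))) <= H y1.
  by apply: Hnd; rewrite -n1 gK1 ge_min lexx orbT.
rewrite /transfer; set a := H (g0 (Num.min _ _)) in h0 *.
set b := H (g1 (Num.min _ _)) in h1 *.
have ea : p * a < p * (H (g0 x) + e) by rewrite ltr_pM2l //; lra.
have eb : (1 - p) * b < (1 - p) * (H (g1 x) + e) by rewrite ltr_pM2l //; lra.
by lra.
Qed.

(** The iterates of [transfer] starting from the supersolution [V] decrease and stay above [L].
    Their pointwise infimum is fixed because [transfer] only averages two values, so a decreasing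
    limit passes through it. *)
Lemma transfer_fixpoint V L : {homo V : x y / x <= y} -> right_usc V ->
  (forall x, transfer V x <= V x) -> (forall x, L x <= transfer L x) ->
  (forall x, L x <= V x) ->
  exists F, [/\ {homo F : x y / x <= y}, right_usc F, forall x, F x = transfer F x
    & forall x, L x <= F x <= V x].
Proof.
move=> Vnd Vusc TV TL LV.
pose H n := iter n transfer V.
have HS n : H n.+1 = transfer (H n) by [].
have Hnd n : {homo H n : x y / x <= y}.
  by elim: n => // n IH; rewrite HS; exact: transfer_nd.
have Husc n : right_usc (H n).
  by elim: n => // n IH; rewrite HS; exact: transfer_right_usc.
have HL n x : L x <= H n x.
  elim: n x => // n IH x; rewrite HS; apply: le_trans (TL x) _.
  exact: transfer_le.
have Hdec n x : H n.+1 x <= H n x.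
  by elim: n x => [|n IH] x; [exact: TV|rewrite HS; exact: transfer_le].
have Hdecm n m x : (n <= m)%N -> H m x <= H n x.
  elim: m => [|m IH]; first by rewrite leqn0 => /eqP ->.
  rewrite leq_eqVlt => /orP[/eqP -> //|nm].
  by apply: le_trans (Hdec m x) (IH _).
pose F x := inf (range (fun n => H n x)).
have infH x : has_inf (range (fun n => H n x)).
  by split; [exists (V x), 0%N|exists (L x) => _ [n _ <-]].
have FH n x : F x <= H n x by apply: ge_inf; [case: (infH x)|exists n].
have Fge x c : (forall n, c <= H n x) -> c <= F x.
  by move=> h; apply: lb_le_inf; [case: (infH x)|move=> _ [n _ <-]].
have Flt x e : 0 < e -> exists n, H n x < F x + e.
  by move=> e0; have [_ [n _ <-]] := inf_adherent e0 (infH x); exists n.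
exists F; split.
- by move=> x y xy; apply: Fge => n; apply: le_trans (FH n x) (Hnd n _ _ xy).
- move=> x e e0; have e2 : 0 < e / 2 by lra.
  have [n Hn] := Flt x _ e2; have [y xy Hy] := Husc n x _ e2.
  by exists y => //; have := FH n y; lra.
- move=> x; apply/eqP; rewrite eq_le; apply/andP; split; last first.
    apply: Fge => n; apply: le_trans (Hdec n x); rewrite HS.
    exact: transfer_le.
  apply/ler_addgt0Pr => e e0.
  have [n0 Hn0] := Flt (g0 x) _ e0; have [n1 Hn1] := Flt (g1 x) _ e0.
  (* By monotonicity in the index, one common index [maxn n0 n1] is good at both points [g0 x] and
     [g1 x]. *)
  have := FH (maxn n0 n1).+1 x; rewrite HS /transfer.
  have := Hdecm _ _ (g0 x) (leq_maxl n0 n1).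
  have := Hdecm _ _ (g1 x) (leq_maxr n0 n1).
  set a := H (maxn _ _) (g0 x); set b := H (maxn _ _) (g1 x) => h1 h0.
  have ea : p * a <= p * (F (g0 x) + e) by rewrite ler_pM2l //; lra.
  have eb : (1 - p) * b <= (1 - p) * (F (g1 x) + e) by rewrite ler_pM2l //; lra.
  by lra.
- by move=> x; rewrite (FH 0%N) andbT; apply: Fge.
Qed.

End transfer.

(* Under the inverse maps, points far to the left drift to the left on average
   and points far to the right drift to the right, so the slowly varying barrier
   and its mirror image are super- and subsolutions of the equation satisfied by
   the distribution function. *)
Lemma statR_exists f0 g0 f1 g1 p l0 r0 l1 r1 :
  incbij f0 g0 -> incbij f1 g1 -> 0 < p < 1 ->
  disp f0 l0 r0 -> disp f1 l1 r1 ->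
  0 < p * l0 + (1 - p) * l1 -> p * r0 + (1 - p) * r1 < 0 ->
  exists mu : probability RT R, statR f0 f1 p mu.
Proof.
move=> fg0 fg1 pI df0 df1 lpos rneg.
have dg0 := disp_inv fg0 df0; have dg1 := disp_inv fg1 df1.
(* Half of each mean drift: replacing the limiting displacements by bounds that are off by [e] keeps
   both drifts of the right sign. *)
pose el := (p * l0 + (1 - p) * l1) / 2.
pose er := - (p * r0 + (1 - p) * r1) / 2.
pose e := Num.min el er.
have e0 : 0 < e by rewrite lt_min /el /er; lra.
have [eel eer] : e <= el /\ e <= er by rewrite !ge_min !lexx orbT.
have [K0 HK0] := dg0 _ e0; have [K1 HK1] := dg1 _ e0.
pose K := `|K0| + `|K1|.
have [KK0 KK1] : K0 <= K /\ K1 <= K.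
  by have := ler_norm K0; have := ler_norm K1; have := normr_ge0 K0;
    have := normr_ge0 K1; rewrite /K; lra.
have bl : p * (- l0 + e) + (1 - p) * (- l1 + e) < 0.
  by move: eel; rewrite /el; lra.
have br : p * (r0 + e) + (1 - p) * (r1 + e) < 0.
  by move: eer; rewrite /er; lra.
have [C1 HC1] := barrier_super K pI bl.
have [C2 HC2] := barrier_super K pI br.
pose C := `|C1| + `|C2| + 1.
have [C0 CC1 CC2] : [/\ 0 < C, C1 <= C & C2 <= C].
  have := ler_norm C1; have := ler_norm C2; have := normr_ge0 C1.
  by have := normr_ge0 C2; rewrite /C; split; lra.
pose L (u : R) := 1 - barrier C (- u).
have TV u : transfer g0 g1 p (barrier C) u <= barrier C u.
  apply: HC1 => // v vK.
  have /(HK0 _).1 : v < - K0 by lra.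
  have /(HK1 _).1 : v < - K1 by lra.
  by rewrite !ltr_norml; lra.
have TL u : L u <= transfer g0 g1 p L u.
  (* Reflection [v -> - v] turns the right end into the left end, so the subsolution [L] comes from
     the supersolution property of the reflected inverse maps. *)
  have := HC2 _ CC2 (fun v => - g0 (- v)) (fun v => - g1 (- v)).
  move=> /(_ _ (- u)); rewrite /= opprK /transfer /L => H.
  suff : p * barrier C (- g0 u) + (1 - p) * barrier C (- g1 u)
     <= barrier C (- u) by lra.
  apply: H => v vK.
  have /(HK0 _).2 : K0 < - v by lra.
  have /(HK1 _).2 : K1 < - v by lra.
  by rewrite !ltr_norml; lra.
(* At least one of [barrier C u] and [barrier C (- u)] equals 1, so their sum is at least 1. *)
have LV u : L u <= barrier C u.
  rewrite /L; have := barrier_ge0 (- u) C0; have := barrier_ge0 u C0.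
  have [uC|uC] := ltP u (- C).
    have -> : barrier C (- u) = 1; last lra.
    by rewrite /barrier; case: ltP => //; lra.
  have -> : barrier C u = 1; last lra.
  by rewrite /barrier; case: ltP => //; lra.
have [F [Fnd Fusc FT FLV]] :=
  transfer_fixpoint fg0 fg1 pI (barrier_nd C0) (barrier_right_usc C0) TV TL LV.
have FN : F x @[x --> -oo] --> (0 : R).
  apply/cvgrPdist_lt => d d0; exists (- (C / d)); split; first exact: num_real.
  move=> x xC; have /andP[FL FV] := FLV x.
  have Cd : 0 < C / d by rewrite divr_gt0.
  have x0 : x < 0 by lra.
  have := barrier_bound C0 (lexx _) x0 => Vx.
  have : C / - x < d.
    by rewrite ltr_pdivrMr; last lra; rewrite mulrC -ltr_pdivrMr //; lra.
  have : 0 <= F x.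
    apply: le_trans FL; rewrite /L.
    by have := barrier_le1 (- x) C0; lra.
  by rewrite ltr_norml; lra.
have Fy : F x @[x --> +oo] --> (1 : R).
  apply/cvgrPdist_lt => d d0; exists (C / d); split; first exact: num_real.
  move=> x xC; have /andP[FL FV] := FLV x.
  have Cd : 0 < C / d by rewrite divr_gt0.
  have x0 : - x < 0 by lra.
  have := barrier_bound C0 (lexx _) x0; rewrite opprK => Vx.
  have : C / x < d.
    by rewrite ltr_pdivrMr; last lra; rewrite mulrC -ltr_pdivrMr //; lra.
  have := barrier_le1 x C0.
  by move: FL; rewrite ltr_norml /L; lra.
have [mu muE] := prob_of_cdf Fnd (right_usc_cvg Fnd Fusc) FN Fy.
exists mu; apply: (cdf_statR fg0 fg1 pI) => x.
by rewrite /cdfR !muE /= FT.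
Qed.

End existence_of_stationary_measures.

(** * The logarithmic coordinate *)

Section logarithmic_coordinate.
Context {R : realType}.

(** The inverse of [hlog], as a map from the line onto the open unit interval. *)
Definition hexp (u : R) : R :=
  if u <= 0 then expR u / 2 else 1 - expR (- u) / 2.

Lemma hexp_itv u : 0 < hexp u < 1.
Proof.
rewrite /hexp; have e1 := expR_gt0 u; have e2 := expR_gt0 (- u).
have [u0|u0] := leP u 0.
  have : expR u <= 1 by rewrite -expR0 ler_expR.
  by lra.
have : expR (- u) <= 1 by rewrite -expR0 ler_expR; lra.
by lra.
Qed.

Lemma unitIo_hexp u : unitIo (hexp u).
Proof. by rewrite /unitIo /= in_itv /= hexp_itv. Qed.

Lemma hexpK : cancel hexp (@hlog R).
Proof.
move=> u; rewrite /hlog /hexp; have e1 := expR_gt0 u; have e2 := expR_gt0 (- u).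
have [u0|u0] := leP u 0.
  have : expR u <= 1 by rewrite -expR0 ler_expR.
  move=> ?; rewrite ifT; last lra.
  by rewrite lnM ?posrE ?invr_gt0 // expRK; lra.
have : expR (- u) < 1 by rewrite -expR0 ltr_expR; lra.
move=> ?; rewrite ifF; last by apply/negbTE; rewrite -ltNge; lra.
have -> : 1 - (1 - expR (- u) / 2) = expR (- u) / 2 by lra.
by rewrite lnM ?posrE ?invr_gt0 // expRK; lra.
Qed.

Lemma hlogK x : 0 < x < 1 -> hexp (hlog x) = x.
Proof.
move=> x01; rewrite /hlog /hexp; have [x2|x2] := leP x 2^-1.
  rewrite ifT; last by rewrite subr_le0 ler_ln ?posrE; lra.
  by rewrite expRD expRN !lnK ?posrE; lra.
rewrite ifF; last by apply/negbTE; rewrite -ltNge subr_gt0 ltr_ln ?posrE; lra.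
by rewrite opprB expRD expRN !lnK ?posrE; lra.
Qed.

Lemma hexp_lt : {homo hexp : u w / u < w}.
Proof.
move=> u w uw; rewrite /hexp.
have e1 := expR_gt0 u; have e2 := expR_gt0 (- w).
have [u0|u0] := leP u 0; have [w0|w0] := leP w 0; last 2 first.
- by lra.
- have : expR (- w) < expR (- u) by rewrite ltr_expR; lra.
  by lra.
- have : expR u < expR w by rewrite ltr_expR.
  by lra.
- have : expR u <= 1 by rewrite -expR0 ler_expR.
  have : expR (- w) < 1 by rewrite -expR0 ltr_expR; lra.
  by lra.
Qed.

Lemma hexp_mono_le : {mono hexp : u w / u <= w}.
Proof. by apply: le_mono; exact: hexp_lt. Qed.

Lemma hexp_mono_lt : {mono hexp : u w / u < w}.
Proof. exact/leW_mono/hexp_mono_le. Qed.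

Lemma hlog_lt (x y : R) : 0 < x < 1 -> 0 < y < 1 -> (hlog x < hlog y) = (x < y).
Proof. by move=> x01 y01; rewrite -[LHS]hexp_mono_lt !hlogK. Qed.

Lemma measurable_hlog : measurable_fun setT (@hlog R).
Proof.
rewrite /hlog; apply: measurable_fun_ifT => //=.
- exact: measurable_fun_ler.
- by apply: measurable_funB => //; exact: measurable_ln.
- apply: measurable_funB => //; apply: measurableT_comp => //.
  exact: measurable_funB.
Qed.

End logarithmic_coordinate.

(** * Singular homeomorphisms *)

Section dyadic_cells.
Context {R : realType}.
Local Notation RT := (measurableTypeR R).

Definition dy (n : nat) (k : int) : R := k%:~R / 2 ^+ n.
Definition idx (n : nat) (x : R) : int := Num.floor (x * 2 ^+ n).
Definition cell (n : nat) (k : int) : set R := `[dy n k, dy n (k + 1)[%classic.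

Let pow_gt0 n : 0 < 2 ^+ n :> R. Proof. by rewrite exprn_gt0. Qed.

(** This adjunction between [idx] and [dy] reduces the combinatorics of dyadic cells to integer
    arithmetic. *)
Lemma idx_ge n x k : (k <= idx n x) = (dy n k <= x).
Proof. by rewrite /idx floor_ge_int /dy ler_pdivrMr. Qed.

Lemma idx_lt n x k : (idx n x < k) = (x < dy n k).
Proof. by rewrite ltNge idx_ge -ltNge. Qed.

Lemma idx_dy n k : idx n (dy n k) = k.
Proof. by rewrite /idx /dy divfK ?gt_eqF // intrKfloor. Qed.

Lemma cellE n k x : cell n k x <-> idx n x = k.
Proof.
rewrite /cell /= in_itv /= -idx_ge -idx_lt; split=> [|->]; last first.
  by rewrite lexx ltrDl.
by rewrite ltzD1 => ?; apply/eqP; rewrite eq_le andbC.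
Qed.

Lemma dyS n k : dy n.+1 (2 * k) = dy n k.
Proof. by rewrite /dy intrM exprS invfM; field; rewrite expf_neq0. Qed.

Lemma idxS n x : idx n.+1 x = 2 * idx n x \/ idx n.+1 x = 2 * idx n x + 1.
Proof.
have h1 : 2 * idx n x <= idx n.+1 x by rewrite idx_ge dyS -idx_ge.
have h2 : idx n.+1 x < 2 * (idx n x + 1) by rewrite idx_lt dyS -idx_lt ltrDl.
lia.
Qed.

Lemma idxS_inv n k x : (idx n x = k) <->
  (idx n.+1 x = 2 * k \/ idx n.+1 x = 2 * k + 1).
Proof. by have := idxS n x; lia. Qed.

Lemma measurable_cell n k : measurable (cell n k : set RT).
Proof. exact: measurable_itv. Qed.

Lemma cell_split n k : cell n k = cell n.+1 (2 * k) `|` cell n.+1 (2 * k + 1).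
Proof.
apply/seteqP; split => x.
  by move=> /cellE/idxS_inv[] h; [left|right]; apply/cellE.
by move=> [] /cellE h; apply/cellE/idxS_inv; [left|right].
Qed.

Lemma cell_disj n k : cell n.+1 (2 * k) `&` cell n.+1 (2 * k + 1) = set0.
Proof.
by apply/seteqP; split => // x [] /cellE h1 /cellE h2; lia.
Qed.

Definition select (P : nat -> int -> bool) n : set R := [set x | P n (idx n x)].

Lemma measurable_select P n : measurable (select P n : set RT).
Proof.
rewrite [select P n](_ : _ =
    \bigcup_k (if P n k then cell n k else set0)); last first.
  apply/seteqP; split => x.
    by move=> Px; exists (idx n x) => //; rewrite Px; apply/cellE.
  by move=> [k _]; case: ifP => // Pk /cellE; rewrite /select /= => ->.
apply: countable_bigcupT_measurable => // k.
by case: ifP => _; [exact: measurable_cell|exact: measurable0].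
Qed.

End dyadic_cells.

(** * Mutual singularity from decay of affinities *)

Section singularity_criterion.
Context {R : realType}.
Local Notation RT := (measurableTypeR R).
Implicit Types (mu rho lam : {measure set RT -> \bar R}) (r l : nat -> int -> R).

(* Geometric decay of the Hellinger affinities [\sum sqrt (r n k * l n k)] of
   two measures along the dyadic partitions. *)
Definition affinity_decay (t : R) r l := forall n k,
  Num.sqrt (r n.+1 (2 * k) * l n.+1 (2 * k)) +
  Num.sqrt (r n.+1 (2 * k + 1) * l n.+1 (2 * k + 1))
  <= t * Num.sqrt (r n k * l n k).

Lemma affinity_decayC t r l : affinity_decay t r l -> affinity_decay t l r.
Proof.
move=> h n k; rewrite (mulrC (l n k)) (mulrC (l n.+1 (2 * k))).
by rewrite (mulrC (l n.+1 (2 * k + 1))).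
Qed.

(** At the finest level, [r <= l] on a selected cell gives [r = sqrt (r * r) <= sqrt (r * l)]. Each
    coarser level splits the cell in two and gains a factor [t] from the decay. *)
Lemma select_cell_le mu r l t (P : nat -> int -> bool) : 0 <= t ->
  (forall n k, mu (cell n k) = (r n k)%:E) ->
  (forall n k, P n k -> r n k <= l n k) -> affinity_decay t r l ->
  forall m n k, (mu (select P (n + m) `&` cell n k) <=
    (t ^+ m * Num.sqrt (r n k * l n k))%:E)%E.
Proof.
move=> t0 mur Pr dec; elim=> [|m IH] n k.
  rewrite addn0 expr0 mul1r; have [Pnk|Pnk] := boolP (P n k); last first.
    rewrite [_ `&` _](_ : _ = set0) ?measure0 ?lee_fin ?sqrtr_ge0 //.
    apply/seteqP; split => // x [] Px /cellE xk.
    by move: Px; rewrite /select /= xk (negbTE Pnk).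
  apply: (@le_trans _ _ (mu (cell n k))).
    apply: le_measure; rewrite ?inE; last exact: subIsetr.
    - by apply: measurableI; [exact: measurable_select|exact: measurable_cell].
    - exact: measurable_cell.
  have r0 : 0 <= r n k by rewrite -lee_fin -mur.
  rewrite mur lee_fin -{1}[r n k]ger0_norm // -sqrtr_sqr ler_wsqrtr //.
  by rewrite expr2 ler_wpM2l // Pr.
rewrite addnS -addSn cell_split setIUr.
have ms j : measurable (select P (n.+1 + m) `&` cell n.+1 j : set RT).
  by apply: measurableI; [exact: measurable_select|exact: measurable_cell].
apply: le_trans (measureU2 _ _ _) _ => //.
apply: le_trans (leeD (IH n.+1 (2 * k)) (IH n.+1 (2 * k + 1))) _.
rewrite -EFinD lee_fin -mulrDr exprSr -mulrA ler_wpM2l ?exprn_ge0 //.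
Qed.

(** Borel-Cantelli is applied inside each cell of level 0, where the bounds form a convergent
    geometric series; the countably many null pieces are then united. *)
Lemma select_limsup0 mu r l t (P : nat -> int -> bool) : 0 <= t < 1 ->
  (forall n k, mu (cell n k) = (r n k)%:E) ->
  (forall n k, P n k -> r n k <= l n k) -> affinity_decay t r l ->
  mu (lim_sup_set (select P)) = 0%E.
Proof.
move=> /andP[t0 t1] mur Pr dec.
have mS n : measurable (select P n : set RT) by exact: measurable_select.
have mL : measurable (lim_sup_set (select P) : set RT).
  by apply: bigcap_measurable => // n _; apply: bigcup_measurable.
have H k : mu (lim_sup_set (select P) `&` cell 0 k) = 0%E.
  pose F n := select P n `&` cell 0 k : set RT.
  have mF n : measurable (F n).
    by apply: measurableI; [exact: measurable_select|exact: measurable_cell].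
  have -> : lim_sup_set (select P) `&` cell 0 k = lim_sup_set F.
    apply/seteqP; split => x.
      by move=> [xL xc] n _; have [j nj xj] := xL n I; exists j.
    move=> xL; split; last by have [j _ []] := xL 0%N I.
    by move=> n _; have [j nj []] := xL n I; exists j.
  apply: lim_sup_set_cvg0 => //.
  pose c := Num.sqrt (r 0%N k * l 0%N k).
  have le n : (mu (F n) <= (c * t ^+ n)%:E)%E.
    by have := select_cell_le t0 mur Pr dec n 0%N k; rewrite add0n mulrC.
  apply: (@le_lt_trans _ _ (\sum_(0 <= n <oo) (c * t ^+ n)%:E)%E).
    by apply: lee_nneseries => // n _; exact: le.
  have cv := @cvg_geometric_series R c t (ltac:(by rewrite ger0_norm)).
  suff -> : (\sum_(0 <= n <oo) (c * t ^+ n)%:E)%E = (c * (1 - t)^-1)%:E.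
    by rewrite ltry.
  apply/cvg_lim => //.
  have -> : (fun n => \sum_(0 <= i < n) (c * t ^+ i)%:E)%E =
            EFin \o series (geometric c t).
    by apply/funext => n; rewrite /= /series /= sumEFin.
  by apply: cvg_EFin; [exact: nearW|exact: cv].
apply: measure_negligible => //.
have H' k : mu.-negligible (lim_sup_set (select P) `&` cell 0 k).
  by apply/negligibleP; [apply: measurableI => //; exact: measurable_cell|exact: H].
(* The integers are enumerated by naturals, one nonnegative and one negative index at a time. *)
pose U n : set RT := (lim_sup_set (select P) `&` cell 0 (Posz n)) `|`
  (lim_sup_set (select P) `&` cell 0 (Negz n)).
have : mu.-negligible (\bigcup_n U n).
  by apply: negligible_bigcup => n; exact: negligibleU.
apply: negligibleS.
move=> x xL; have xc : cell 0 (idx 0 x) x by apply/cellE.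
by case: (idx 0 x) xc => n xc; exists n => //; [left|right].
Qed.

(** [B] consists of the points lying infinitely often in cells with [l < r]. It is null for [lam],
    and its complement lies in the set of points that are infinitely often in cells with [r <= l],
    which is null for [rho]. *)
Lemma affinity_decay_singular rho lam r l t : 0 <= t < 1 ->
  (forall n k, rho (cell n k) = (r n k)%:E) ->
  (forall n k, lam (cell n k) = (l n k)%:E) -> affinity_decay t r l ->
  exists B : set RT, [/\ measurable B, rho (~` B) = 0%E & lam B = 0%E].
Proof.
move=> t01 rhor laml dec.
pose P n k := r n k <= l n k; pose Q n k := ~~ P n k.
have mS S n : measurable (select S n : set RT) by exact: measurable_select.
have mL S : measurable (lim_sup_set (select S) : set RT).
  by apply: bigcap_measurable => // n _; apply: bigcup_measurable.
exists (lim_sup_set (select Q)); split => //; last first.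
  apply: (select_limsup0 t01 laml _ (affinity_decayC dec)) => n k.
  by rewrite /Q /P -ltNge => /ltW.
apply: (@subset_measure0 _ _ _ rho _ (lim_sup_set (select P))) => //.
- exact: measurableC.
- move=> x; rewrite /lim_sup_set /= => /existsNP[n /not_implyP[_ xn]] m _.
  exists (maxn n m); first exact: leq_maxr.
  apply: contrapT => h; apply: xn; exists (maxn n m); first exact: leq_maxl.
  by rewrite /select /= /Q; apply/negP.
- exact: (select_limsup0 t01 rhor _ dec).
Qed.

End singularity_criterion.

(** * The homeomorphism built by skewed bisection *)

Section skewed_homeomorphism.
Context {R : realType}.
Variables (e : int -> R) (r : nat -> int -> R).
Hypothesis e_lt : forall k, e k < e (k + 1).
Hypothesis e_itv : forall k, 0 < e k < 1.

(* Each cell is cut in two with the proportions 1 : 4, the small part being the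
   image of the half that carries more [r]-mass. *)
Definition wt n k : R :=
  if r n.+1 (2 * k + 1) <= r n.+1 (2 * k) then 5^-1 else 4 / 5.

(** The value prescribed at the dyadic point [dy n j]. An even [j] is a vertex inherited from the
    previous level, an odd one is a new cutting point. *)
Fixpoint vtx (n : nat) (j : int) : R :=
  if n is n'.+1 then
    let k := (j %/ 2)%Z in
    if (j %% 2)%Z == 0 then vtx n' k
    else vtx n' k + wt n' k * (vtx n' (k + 1) - vtx n' k)
  else e j.

Lemma wt_itv n k : 5^-1 <= wt n k <= 4 / 5.
Proof. by rewrite /wt; case: ifP => _; lra. Qed.

Lemma vtxS0 n k : vtx n.+1 (2 * k) = vtx n k.
Proof. by rewrite /= mulrC modzMl eqxx mulzK. Qed.

Lemma vtxS1 n k :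
  vtx n.+1 (2 * k + 1) = vtx n k + wt n k * (vtx n (k + 1) - vtx n k).
Proof.
rewrite /= mulrC modzMDl divzMDl // (_ : (1 %/ 2)%Z = 0) // addr0.
by rewrite (_ : (1 %% 2)%Z == 0 = false).
Qed.

Lemma parity (j : int) : exists k, j = 2 * k \/ j = 2 * k + 1.
Proof. by exists (j %/ 2)%Z; lia. Qed.

(** Each cut leaves pieces of relative length between 1/5 and 4/5. The lower bound will give
    injectivity and the upper bound continuity. *)
Lemma vtx_gap n k : 0 < vtx n (k + 1) - vtx n k <= (4 / 5) ^+ n.
Proof.
elim: n k => [|n IH] j.
  by have := e_itv j; have := e_itv (j + 1); have := e_lt j; rewrite expr0 /=; lra.
have [k jk] := parity j; have /andP[d0 d1] := IH k.
have /andP[w0 w1] := wt_itv n k.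
set d := vtx n (k + 1) - vtx n k in d0 d1.
have wd0 : 5^-1 * d <= wt n k * d by rewrite ler_pM2r.
have wd1 : wt n k * d <= 4 / 5 * d by rewrite ler_pM2r.
have pd : 4 / 5 * d <= (4 / 5) ^+ n.+1 by rewrite exprS ler_pM2l //; lra.
case: jk => ->.
  rewrite vtxS1 vtxS0 -/d; lra.
have -> : 2 * k + 1 + 1 = 2 * (k + 1) by lia.
rewrite vtxS1 vtxS0 -/d.
have -> : vtx n (k + 1) - (vtx n k + wt n k * d) = d - wt n k * d by rewrite /d; ring.
by lra.
Qed.

Lemma vtx_lt n : {homo vtx n : j k / j < k}.
Proof.
move=> j k jk; have [m ->] : exists m : nat, k = j + m.+1%:Z.
  by exists (`|k - j|%N.-1); lia.
elim: m => [|m IH]; first by have := vtx_gap n j; lra.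
apply: lt_trans IH _; have := vtx_gap n (j + m.+1%:Z).
have -> : j + m.+1%:Z + 1 = j + m.+2%:Z by lia.
by lra.
Qed.

Lemma vtx_le n : {mono vtx n : j k / j <= k}.
Proof. by apply: le_mono; exact: vtx_lt. Qed.

Lemma vtx_idx_itv n m (x : R) : (n <= m)%N ->
  vtx n (idx n x) <= vtx m (idx m x) /\
  vtx m (idx m x + 1) <= vtx n (idx n x + 1).
Proof.
elim: m => [|m IH]; first by rewrite leqn0 => /eqP ->.
rewrite leq_eqVlt => /orP[/eqP -> //|/IH[h1 h2]].
suff : vtx m (idx m x) <= vtx m.+1 (idx m.+1 x) /\
       vtx m.+1 (idx m.+1 x + 1) <= vtx m (idx m x + 1) by lra.
by rewrite -vtxS0 -[vtx m (_ + 1)]vtxS0 !vtx_le; have := idxS m x; lia.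
Qed.

(** The image cells around [x] are nested, and their left ends increase to the value at [x]. *)
Definition skewmap (x : R) : R := sup (range (fun n => vtx n (idx n x))).

Lemma vtx_idx_lt n m (x : R) : vtx m (idx m x) < vtx n (idx n x + 1).
Proof.
have [_ h1] := vtx_idx_itv x (leq_maxl n m).
have [h2 _] := vtx_idx_itv x (leq_maxr n m).
by have := vtx_gap (maxn n m) (idx (maxn n m) x); lra.
Qed.

Lemma skew_itv n x : vtx n (idx n x) <= skewmap x <= vtx n (idx n x + 1).
Proof.
have ub : ubound (range (fun n => vtx n (idx n x))) (vtx n (idx n x + 1)).
  by move=> _ [m _ <-]; exact/ltW/vtx_idx_lt.
apply/andP; split; last by apply: ge_sup => //; exists (vtx 0 (idx 0 x)), 0%N.
by apply: ub_le_sup; [exists (vtx n (idx n x + 1))|exists n].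
Qed.

(** A dyadic point remains a vertex with the same value at every finer level. *)
Lemma skew_dy n k : skewmap (dy n k) = vtx n k.
Proof.
have H i : exists j, dy n k = dy (n + i) j :> R /\ vtx (n + i) j = vtx n k.
  elim: i => [|i [j [h1 h2]]]; first by exists k; rewrite addn0.
  by exists (2 * j); rewrite addnS dyS vtxS0.
apply/eqP; rewrite eq_le; have /andP[+ _] := skew_itv n (dy n k).
rewrite idx_dy => ->; rewrite andbT.
apply: ge_sup; first by exists (vtx 0 (idx 0 (dy n k : R))), 0%N.
move=> _ [m _ <-]; have [h _] := vtx_idx_itv (dy n k) (leq_maxr n m).
apply: le_trans h _; have [j] := H (maxn n m - n)%N.
by rewrite subnKC ?leq_maxl // => -[{1}-> <-]; rewrite idx_dy.
Qed.

Lemma skew01 x : 0 < skewmap x < 1.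
Proof.
have /= := skew_itv 0 x; have := e_itv (idx 0 x); have := e_itv (idx 0 x + 1).
by lra.
Qed.

Lemma pow2_large (c : R) : exists n : nat, c < 2 ^+ n.
Proof.
exists (Num.trunc c).+1; apply: lt_trans (truncnS_gt c) _.
by rewrite -natrX ltr_nat ltn_expl.
Qed.

Lemma skew_lt : {homo skewmap : x y / x < y}.
Proof.
move=> x y xy; have [n Hn] := pow2_large (2 / (y - x)).
have n0 : 0 < 2 ^+ n :> R by rewrite exprn_gt0.
(* Being two cells apart leaves a full cell between the two points, and its image has positive
   length. *)
have : idx n x + 2 <= idx n y.
  rewrite idx_ge /dy ler_pdivrMr // intrD.
  have := floor_le (x * 2 ^+ n); rewrite -/(idx n x) => h.
  have : 2 < 2 ^+ n * (y - x) by rewrite -ltr_pdivrMr // subr_gt0.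
  by rewrite (_ : 2%:~R = 2) //; lra.
rewrite -(vtx_le n) => h.
have /andP[_ h1] := skew_itv n x; have /andP[h2 _] := skew_itv n y.
have := vtx_gap n (idx n x + 1); rewrite (_ : idx n x + 1 + 1 = idx n x + 2).
  by lra.
by rewrite -addrA.
Qed.

(** A point within one mesh width of [x] lies in the cell of [x] or in an adjacent one, so the
    values differ by at most two image cells, each shorter than [d / 4]. *)
Lemma skew_continuous : continuous skewmap.
Proof.
move=> x; apply/cvgrPdist_lt => d d0.
have lt45 : `|4 / 5 : R| < 1 by rewrite ger0_norm; lra.
have d3 : 0 < d / 4 by lra.
have /cvgrPdist_lt/(_ _ d3)[n _ Hn] := cvg_expr lt45.
have {}Hn := Hn n (leqnn n); rewrite /= sub0r normrN in Hn.
have {}Hn := le_lt_trans (ler_norm _) Hn.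
have n0 : 0 < 2 ^+ n :> R by rewrite exprn_gt0.
have n1 : 0 < (2 ^+ n)^-1 :> R by rewrite invr_gt0.
near=> y; have /andP[h1 h2] : x - (2 ^+ n)^-1 < y < x + (2 ^+ n)^-1.
  by rewrite -ltr_distl distrC; near: y; exact: cvgr_dist_lt.
have e1 : idx n x - 1 <= idx n y.
  rewrite idx_ge /dy ler_pdivrMr // intrB.
  have := floor_le (x * 2 ^+ n); rewrite -/(idx n x).
  have : (x - (2 ^+ n)^-1) * 2 ^+ n < y * 2 ^+ n by rewrite ltr_pM2r.
  by rewrite mulrBl mulVf ?gt_eqF // (_ : 1%:~R = 1) //; lra.
have e2 : idx n y < idx n x + 2.
  rewrite idx_lt /dy ltr_pdivlMr // intrD.
  have /andP[_] := floor_itv (x * 2 ^+ n); rewrite -/(idx n x) intrD.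
  have : y * 2 ^+ n < (x + (2 ^+ n)^-1) * 2 ^+ n by rewrite ltr_pM2r.
  by rewrite mulrDl mulVf ?gt_eqF // (_ : 1%:~R = 1) // (_ : 2%:~R = 2) //; lra.
have e3 : idx n y + 1 <= idx n x + 2 by lia.
rewrite -(vtx_le n) in e1; rewrite -(vtx_le n) in e3.
have := vtx_gap n (idx n x - 1); rewrite subrK => g1.
have := vtx_gap n (idx n x) => g2.
have := vtx_gap n (idx n x + 1); rewrite (_ : idx n x + 1 + 1 = idx n x + 2) => [g3|].
  have /andP[a1 a2] := skew_itv n x; have /andP[b1 b2] := skew_itv n y.
  by rewrite ltr_norml; lra.
by rewrite -addrA.
Unshelve. all: by end_near. Qed.

Lemma skew_surj z a b : e a <= z <= e b -> exists x, skewmap x = z.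
Proof.
move=> /andP[az zb]; have ab : a <= b by rewrite -(vtx_le 0) /=; lra.
have sE k : skewmap (dy 0 k) = e k by rewrite skew_dy.
have := @IVT R skewmap (dy 0 a) (dy 0 b) z; rewrite !sE.
case.
- by rewrite /dy expr0 !divr1 ler_int.
- by apply: continuous_subspaceT => x; exact: skew_continuous.
- by rewrite ge_min az le_max zb orbT.
- by move=> x _ <-; exists x.
Qed.

(** The worst case is that of two halves of equal mass, where the squared ratio is
    [(sqrt (1/5) + sqrt (4/5)) ^ 2 / 2 = 9/10]. *)
Lemma vtx_affinity : (forall n k, 0 <= r n k) ->
  (forall n k, r n k = r n.+1 (2 * k) + r n.+1 (2 * k + 1)) ->
  affinity_decay (Num.sqrt (9 / 10)) r (fun n k => vtx n (k + 1) - vtx n k).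
Proof.
move=> r0 radd n k.
have -> : 2 * k + 1 + 1 = 2 * (k + 1) by lia.
rewrite !vtxS1 !vtxS0.
have /andP[d0 _] := vtx_gap n k; have := wt_itv n k.
set d := vtx n (k + 1) - vtx n k in d0 *.
have -> : vtx n k + wt n k * d - vtx n k = wt n k * d by ring.
have -> : vtx n (k + 1) - (vtx n k + wt n k * d) = (1 - wt n k) * d.
  by rewrite /d; ring.
set w := wt n k => wI; rewrite (radd n k).
have := r0 n.+1 (2 * k); have := r0 n.+1 (2 * k + 1).
have : w = 5^-1 /\ r n.+1 (2 * k + 1) <= r n.+1 (2 * k) \/
       w = 4 / 5 /\ r n.+1 (2 * k) <= r n.+1 (2 * k + 1).
  rewrite /w /wt; case: leP => h; [by left|right]; split => //; exact: ltW.
set a := r n.+1 (2 * k); set b := r n.+1 (2 * k + 1) => H b0 a0.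
rewrite -sqrtrM; last lra.
have ad0 : 0 <= a * d by rewrite mulr_ge0 // ltW.
have bd0 : 0 <= b * d by rewrite mulr_ge0 // ltW.
have wa : 0 <= a * (w * d) by rewrite !mulr_ge0 //; lra.
have wb : 0 <= b * ((1 - w) * d) by rewrite !mulr_ge0 //; lra.
have s0 : 0 <= Num.sqrt (a * (w * d)) + Num.sqrt (b * ((1 - w) * d)).
  by rewrite addr_ge0 ?sqrtr_ge0.
rewrite -[leLHS]ger0_norm // -sqrtr_sqr ler_wsqrtr //.
have := sqr_sqrtr wa; have := sqr_sqrtr wb.
set x := Num.sqrt (a * _); set y := Num.sqrt (b * _) => yE xE.
case: H => -[wE ab].
  have abd : b * d <= a * d by rewrite ler_wpM2r // ltW.
  (* The weights 3 and 3/2 make the next inequality an equality when [y = 2 * x], which is what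
     happens in the worst case [a = b]. *)
  have sq : 0 <= (2 * x - y) ^+ 2 by rewrite sqr_ge0.
  have : (x + y) ^+ 2 <= 3 * x ^+ 2 + 3 / 2 * y ^+ 2 by lra.
  by rewrite xE yE wE; lra.
have abd : a * d <= b * d by rewrite ler_wpM2r // ltW.
have sq : 0 <= (2 * y - x) ^+ 2 by rewrite sqr_ge0.
have : (x + y) ^+ 2 <= 3 * y ^+ 2 + 3 / 2 * x ^+ 2 by lra.
by rewrite xE yE wE; lra.
Qed.

End skewed_homeomorphism.

(** * Small perturbations of the identity that make a given measure singular *)

Section singular_perturbation.
Context {R : realType}.
Local Notation RT := (measurableTypeR R).
Implicit Types (mu : probability RT R).

Lemma lebesgue_unitIo : exists m : probability RT R,
  forall A, m A = lebesgue_measure (A `&` @unitIo R).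
Proof.
have m1 : mrestr (@lebesgue_measure R) (measurable_itv `]0 : R, 1[) setT = 1%E.
  by rewrite /mrestr setTI lebesgue_measure_itv /= lte_fin ltr01 oppr0 adde0.
pose b := @Measure_isProbability.Build _ RT R _ m1.
pose P : probability RT R :=
  HB.pack (mrestr (@lebesgue_measure R) (measurable_itv `]0 : R, 1[)) b.
by exists P.
Qed.

Lemma cube_le (u w : R) : u <= w -> u ^+ 3 <= w ^+ 3.
Proof.
move=> uw; rewrite -subr_ge0.
have -> : w ^+ 3 - u ^+ 3 = (w - u) * ((w + u / 2) ^+ 2 + 3 / 4 * u ^+ 2) by field.
by rewrite mulr_ge0 ?subr_ge0 // addr_ge0 ?sqr_ge0 // mulr_ge0 // sqr_ge0.
Qed.

Lemma cubic_surj M (f0 g0 f1 g1 : R -> R) : 0 < M -> incbij f0 g0 ->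
  incbij f1 g1 ->
  exists chi', incbij (fun u => u ^+ 3 + M * (u + f0 u + f1 u)) chi'.
Proof.
move=> M0 fg0 fg1; set chi := fun u : R => _.
have m0 := incbij_mono_le fg0; have m1 := incbij_mono_le fg1.
have chi_lt : {homo chi : u w / u < w}.
  move=> u w uw; rewrite /chi; have uw' := ltW uw.
  have h3 : u ^+ 3 <= w ^+ 3 by exact: cube_le.
  have : M * u < M * w by rewrite ltr_pM2l.
  have : M * f0 u <= M * f0 w by rewrite ler_pM2l // m0.
  have : M * f1 u <= M * f1 w by rewrite ler_pM2l // m1.
  lra.
apply: incbij_of_surj => // y.
(* [c] is the value of [chi] at 0, and [b] satisfies [M * b = |y| + |c|]; the other terms being
   monotone, [chi (- b) <= y <= chi b]. *)
pose c := M * (f0 0 + f1 0); pose b := (`|y| + `|c|) / M.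
have b0 : 0 <= b by rewrite divr_ge0 ?addr_ge0 // ltW.
have bM : M * b = `|y| + `|c| by rewrite mulrC divfK ?gt_eqF.
have := ler_norm y; have := ler_norm (- y); have := ler_norm c.
have := ler_norm (- c); rewrite !normrN => *.
have bl : M * (f0 0) <= M * (f0 b) /\ M * (f1 0) <= M * (f1 b).
  by rewrite !ler_pM2l // m0 m1.
have bu : M * (f0 (- b)) <= M * (f0 0) /\ M * (f1 (- b)) <= M * (f1 0).
  by rewrite !ler_pM2l // m0 m1 oppr_le0.
have b3 : 0 <= b ^+ 3 by rewrite exprn_ge0.
have cE : c = M * f0 0 + M * f1 0 by rewrite /c mulrDr.
have h1 : y <= chi b by rewrite /chi; lra.
have h2 : chi (- b) <= y.
  have -> : chi (- b) = - b ^+ 3 + M * (- b + f0 (- b) + f1 (- b)).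
    by rewrite /chi; ring.
  by lra.
have chi_cont : continuous chi.
  move=> u; apply: cvgD; first exact: exprn_continuous.
  apply: cvgM; first exact: cvg_cst.
  apply: cvgD; last exact: (incbij_continuous fg1).
  by apply: cvgD; [exact: cvg_id|exact: (incbij_continuous fg0)].
have := @IVT R chi (- b) b y; case.
- by lra.
- by apply: continuous_subspaceT => u; exact: chi_cont.
- by rewrite ge_min h2 le_max h1 orbT.
- by move=> x _ <-; exists x.
Qed.

(** All summands are nondecreasing, so their increments have the same sign and each is bounded by
    the total increment. *)
Lemma cubic_increment M (f0 g0 f1 g1 : R -> R) (u w : R) : 0 < M ->
  incbij f0 g0 -> incbij f1 g1 ->
  `|(u ^+ 3 + M * (u + f0 u + f1 u)) - (w ^+ 3 + M * (w + f0 w + f1 w))| <= 1 ->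
  [/\ M * `|u - w| <= 1, M * `|f0 u - f0 w| <= 1, M * `|f1 u - f1 w| <= 1
    & `|u ^+ 3 - w ^+ 3| <= 1].
Proof.
move=> M0 fg0 fg1; have m0 := incbij_mono_le fg0; have m1 := incbij_mono_le fg1.
wlog uw : u w / u <= w.
  move=> H; have [/H //|/ltW/H {}H] := leP u w.
  by rewrite distrC => /H; rewrite !(distrC _ u) !(distrC _ (f0 u)) !(distrC _ (f1 u))
    (distrC _ (u ^+ 3)).
have h3 : u ^+ 3 <= w ^+ 3 by exact: cube_le.
have h4 : M * u <= M * w by rewrite ler_pM2l.
have h5 : M * f0 u <= M * f0 w by rewrite ler_pM2l // m0.
have h6 : M * f1 u <= M * f1 w by rewrite ler_pM2l // m1.
have h0 : f0 u <= f0 w by rewrite m0.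
have h1 : f1 u <= f1 w by rewrite m1.
rewrite ler_norml => /andP[h _].
have nE (a b : R) : a <= b -> `|a - b| = b - a.
  by move=> ab; rewrite distrC ger0_norm // subr_ge0.
by rewrite !nE //; split; lra.
Qed.

(** The quotient of [h u ^ 3 - u ^ 3] by [h u - u] is at least [3/4 * u ^ 2], hence [|h u - u|] is
    at most [4 / (3 * u ^ 2)]. The summand 1 in the threshold ensures [|u| <= u ^ 2]. *)
Lemma cube_disp (h : R -> R) :
  (forall u, `|h u ^+ 3 - u ^+ 3| <= 1) -> disp h 0 0.
Proof.
move=> H d d0; exists (4 / 3 / d + 1) => u.
have key : 4 / 3 / d + 1 < `|u| -> `|h u - u| < d.
  move=> uK; have d1 : 0 < 4 / 3 / d by rewrite divr_gt0.
  have dE : 4 / 3 / d * d = 4 / 3 by rewrite divfK ?gt_eqF.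
  have u2 : 4 / 3 / d < u ^+ 2.
    rewrite -real_normK ?num_real //.
    have : 1 * `|u| <= `|u| * `|u| by rewrite ler_wpM2r //; lra.
    by rewrite expr2; lra.
  have := H u; have -> : h u ^+ 3 - u ^+ 3 =
    (h u - u) * ((h u + u / 2) ^+ 2 + 3 / 4 * u ^+ 2) by field.
  have sq := sqr_ge0 (h u + u / 2).
  rewrite normrM (@ger0_norm _ ((h u + u / 2) ^+ 2 + _)); last first.
    by rewrite addr_ge0 // mulr_ge0 // sqr_ge0.
  have := normr_ge0 (h u - u); set a := `|h u - u| => a0.
  move=> le1; rewrite ltNge; apply/negP => da.
  have : d * (3 / 4 * u ^+ 2) <= a * ((h u + u / 2) ^+ 2 + 3 / 4 * u ^+ 2).
    by apply: ler_pM; [lra|rewrite mulr_ge0 // sqr_ge0|done|lra].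
  have : 4 / 3 / d * d < u ^+ 2 * d by rewrite ltr_pM2r.
  by lra.
have u1 := ler_norm u; have := ler_norm (- u); rewrite normrN => u2.
by split=> hu; rewrite subr0; apply: key; lra.
Qed.

(** The perturbation is [kappa \o chi], with [kappa] the skewed homeomorphism for the image [rho] of
    [mu] under [chi], read in the coordinate [hlog]. The affinity criterion separates [rho] from the
    pullback [lam] of Lebesgue measure under [skewmap]. *)
Lemma singular_perturbation (f0 g0 f1 g1 : R -> R) mu (eps : R) : 0 < eps ->
  incbij f0 g0 -> incbij f1 g1 ->
  exists eta eta' : R -> R, [/\ incbij eta eta', disp eta 0 0,
    forall u, [/\ `|eta u - u| <= eps, `|f0 (eta u) - f0 u| <= eps
      & `|f1 (eta u) - f1 u| <= eps]
    & exists B : set RT, [/\ measurable B, mu (eta @^-1` B) = 1%E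
      & lebesgue_measure (@hlog R @^-1` B `&` @unitIo R) = 0%E]].
Proof.
move=> eps0 fg0 fg1; pose M := eps^-1.
have M0 : 0 < M by rewrite invr_gt0.
have [chi' chiP] := cubic_surj M0 fg0 fg1.
have := @cubic_increment M f0 g0 f1 g1 _ _ M0 fg0 fg1.
set chi := (fun u => _) in chiP; rewrite -/(chi _) => inc.
have {}inc u w : `|chi u - chi w| <= 1 ->
    [/\ `|u - w| <= eps, `|f0 u - f0 w| <= eps, `|f1 u - f1 w| <= eps
    & `|u ^+ 3 - w ^+ 3| <= 1].
  by move=> /inc; rewrite /M !ler_pdivrMl // !mulr1.
have chi_le := incbij_mono_le chiP.
have [chi_lt chiK chi'K] := chiP.
have [rho rhoE] := prob_pushforward mu (incbij_measurable chiP).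
(* This choice of level-0 vertices forces [kappa k = chi' k] at integers, so [kappa \o chi] fixes
   every [chi' k] and maps each unit cell of [chi] to itself. *)
pose e (k : int) : R := hexp (chi' k%:~R).
have e_lt k : e k < e (k + 1).
  by rewrite hexp_mono_lt (incbij_mono_lt (incbij_sym chiP)) ltr_int ltrDl.
have e_itv k : 0 < e k < 1 by exact: hexp_itv.
pose r n k := fine (rho (cell n k)).
have rE n k : rho (cell n k) = (r n k)%:E.
  by rewrite /r fineK // fin_num_measure //; exact: measurable_cell.
have r0 n k : 0 <= r n k by rewrite fine_ge0.
have radd n k : r n k = r n.+1 (2 * k) + r n.+1 (2 * k + 1).
  apply: EFin_inj; rewrite EFinD -!rE cell_split measureU //.
  - exact: measurable_cell.
  - exact: measurable_cell.
  - exact: cell_disj.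
pose sk := skewmap e r.
have sk01 := skew01 r e_lt e_itv.
pose kappa u := hlog (sk u).
have kappa_lt : {homo kappa : u w / u < w}.
  by move=> u w uw; rewrite /kappa hlog_lt // (skew_lt r e_lt e_itv).
have kappa_surj u : exists x, kappa x = u.
  have [|x xE] := @skew_surj R e r e_lt e_itv (hexp u)
    (Num.floor (chi u)) (Num.floor (chi u) + 1).
    have /andP[h1 h2] := floor_itv (chi u).
    rewrite /e !hexp_mono_le -chi_le chi'K h1 /=.
    by rewrite -chi_le chi'K ltW.
  by exists x; rewrite /kappa /sk xE hexpK.
have [kappa' kappaP] := incbij_of_surj kappa_lt kappa_surj.
have [_ kappaK kappa'K] := kappaP.
have kappaE (k : int) : kappa k%:~R = chi' k%:~R.
  have := skew_dy r e_lt e_itv 0 k; rewrite /dy expr0 divr1 /= => H.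
  by rewrite /kappa /sk H hexpK.
have kappa_le := incbij_mono_le kappaP.
have close u : `|chi (kappa (chi u)) - chi u| <= 1.
  have /andP[h1 h2] := floor_itv (chi u).
  have h3 : (Num.floor (chi u))%:~R <= chi (kappa (chi u)).
    by rewrite -[leLHS]chi'K chi_le -kappaE kappa_le.
  have h4 : chi (kappa (chi u)) <= (Num.floor (chi u) + 1)%:~R.
    by rewrite -[leRHS]chi'K chi_le -kappaE kappa_le ltW.
  by move: h2 h4; rewrite intrD ler_norml (_ : 1%:~R = 1) //; lra.
exists (kappa \o chi), (chi' \o kappa'); split.
- exact: incbij_comp.
- by apply: cube_disp => u; case: (inc _ _ (close u)).
- by move=> u; case: (inc _ _ (close u)).
have [m mE] := lebesgue_unitIo.
have mk : measurable_fun setT (kappa' \o @hlog R).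
  apply: measurableT_comp; last exact: measurable_hlog.
  exact: (incbij_measurable (incbij_sym kappaP)).
(* On the open unit interval, [kappa' \o hlog] is the inverse of [sk], so [lam] gives each cell the
   length of its image. *)
have [lam lamE] := prob_pushforward m mk.
have lamC n k : lam (cell n k) = (vtx e r n (k + 1) - vtx e r n k)%:E.
  rewrite lamE mE; have := skew_dy r e_lt e_itv n k.
  have := skew_dy r e_lt e_itv n (k + 1); rewrite -/sk => <- <-.
  rewrite [X in lebesgue_measure X](_ : _ = `[sk (dy n k), sk (dy n (k + 1))[%classic).
    rewrite lebesgue_measure_itv /= lte_fin (skew_lt r e_lt e_itv) //.
    by rewrite /dy ltr_pM2r ?invr_gt0 ?exprn_gt0 // ltr_int ltrDl.
  have kl y z : 0 < z < 1 -> (kappa' (hlog z) < y) = (z < sk y).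
    move=> z01; rewrite -(incbij_mono_lt kappaP) kappa'K /kappa hlog_lt //.
  apply/seteqP; split => z /=; rewrite /cell /unitIo /= !in_itv /=.
    by move=> [+ z01]; rewrite leNgt !kl // -leNgt.
  move=> /andP[h1 h2].
  have /andP[z0 _] := sk01 (dy n k); have /andP[_ z1] := sk01 (dy n (k + 1)).
  have z01 : 0 < z < 1 by rewrite (lt_le_trans z0 h1) (lt_trans h2 z1).
  by rewrite leNgt !kl // -leNgt h1 h2 z01.
have t01 : 0 <= Num.sqrt (9 / 10 : R) < 1.
  by rewrite sqrtr_ge0 -[ltRHS]sqrtr1 ltr_sqrt //; lra.
have [B [mB rhoB lamB]] := affinity_decay_singular t01 rE lamC
  (vtx_affinity e_lt e_itv r0 radd).
exists (kappa' @^-1` B); split.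
- rewrite -[X in measurable X]setTI.
  by apply: (incbij_measurable (incbij_sym kappaP)).
- have -> : (kappa \o chi) @^-1` (kappa' @^-1` B) = chi @^-1` B.
    by apply/seteqP; split => x /=; rewrite kappaK.
  rewrite -rhoE -(setCK B) probability_setC; last exact: measurableC.
  by rewrite rhoB sube0.
- rewrite -mE; apply: etrans lamB; exact/esym/lamE.
Qed.

End singular_perturbation.

(** * Transfer between the interval and the line *)

Section interval_to_line.
Context {R : realType}.
Implicit Types f : R -> R.

Definition fhat f (u : R) : R := hlog (f (hexp u)).

(** A continuous injection of a segment is monotone, and fixing 0 and 1 makes it increasing.
    Interior points have interior preimages because the endpoints are fixed. *)
Lemma fhat_incbij f : isCI f -> homeoI f -> exists g, incbij (fhat f) g.
Proof.
move=> fCI [g [_ _ gK _]]; have fI x : 0 < x < 1 -> 0 < f x < 1.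
  move=> x01; have : unitIo (f x).
    by apply: (CI_interior fCI); exists x; rewrite // /unitIo /= in_itv.
  by rewrite /unitIo /= in_itv.
have f_inj : {in `[0, 1]%R &, injective f}.
  by move=> x y xI yI fxy; rewrite -(gK x xI) -(gK y yI) fxy.
have f_le : {in `[0, 1]%R &, {mono f : x y / x <= y}}.
  apply: itv_continuous_inj_le f_inj; last exact: (CI_continuous fCI).
  exists 0, 1; rewrite !in_itv /= !lexx !ler01 ltr01.
  by rewrite (CI_0 fCI) (CI_1 fCI).
have f_lt x y : 0 < x < 1 -> 0 < y < 1 -> x < y -> f x < f y.
  move=> x01 y01 xy; rewrite (leW_mono_in f_le) // in_itv /=; lra.
apply: incbij_of_surj => [u w uw|v].
  rewrite /fhat hlog_lt ?fI ?hexp_itv //.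
  by rewrite f_lt ?hexp_itv ?hexp_lt.
have /andP[v0 v1] := hexp_itv v.
have : unitI (hexp v) by rewrite /unitI /= in_itv /= !ltW.
rewrite -(CI_onto fCI) => -[x]; rewrite /unitI /= in_itv /= => /andP[x0 x1] fx.
have x01 : 0 < x < 1.
  rewrite !lt_neqAle x0 x1 !andbT; apply/andP; split; apply/eqP => xE.
    by move: v0; rewrite -fx -xE (CI_0 fCI) ltxx.
  by move: v1; rewrite -fx xE (CI_1 fCI) ltxx.
by exists (hlog x); rewrite /fhat hlogK // fx hexpK.
Qed.

(** When [x] and [f x] are both at most 1/2, the displacement is exactly [ln (f x / x)]; near 1 it
    is [- ln ((1 - f x) / (1 - x))]. The limits are those of the difference quotients. *)
Lemma fhat_disp f : isCI f ->
  disp (fhat f) (ln (derivI0 f)) (- ln (derivI1 f)).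
Proof.
move=> fCI d d0.
have fI x : 0 < x < 1 -> 0 < f x < 1.
  move=> x01; have : unitIo (f x).
    by apply: (CI_interior fCI); exists x; rewrite // /unitIo /= in_itv.
  by rewrite /unitIo /= in_itv.
have a0 := CI_deriv0_gt0 fCI; have b0 := CI_deriv1_gt0 fCI.
have ac : (f x - f 0) / (x - 0) @[x --> 0^'+] --> derivI0 f by exact: CI_cvg0 fCI.
have bc : (f x - f 1) / (x - 1) @[x --> 1^'-] --> derivI1 f by exact: CI_cvg1 fCI.
have lac : ln ((f x - f 0) / (x - 0)) @[x --> 0^'+] --> ln (derivI0 f).
  exact: (continuous_cvg _ (continuous_ln a0) ac).
have lbc : ln ((f x - f 1) / (x - 1)) @[x --> 1^'-] --> ln (derivI1 f).
  exact: (continuous_cvg _ (continuous_ln b0) bc).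
have /cvgrPdist_lt/(_ _ ltr01)[d1 /= d10 H1] := ac.
have /cvgrPdist_lt/(_ _ d0)[d2 /= d20 H2] := lac.
have /cvgrPdist_lt/(_ _ ltr01)[d3 /= d30 H3] := bc.
have /cvgrPdist_lt/(_ _ d0)[d4 /= d40 H4] := lbc.
set a := derivI0 f in a0 H1 H2 *; set b := derivI1 f in b0 H3 H4 *.
pose t := Num.min (Num.min d1 d2) (Num.min d3 d4).
(* Near 0 the slope is below [a + 1], so [x <= qa / 2] ensures [f x <= 1/2]; [qb] plays the same
   part near 1. *)
have [qa qa0 qaE] : exists2 q : R, 0 < q & (a + 1) * q = 1.
  by exists (a + 1)^-1; rewrite ?invr_gt0 ?divff ?gt_eqF //; lra.
have [qb qb0 qbE] : exists2 q : R, 0 < q & (b + 1) * q = 1.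
  by exists (b + 1)^-1; rewrite ?invr_gt0 ?divff ?gt_eqF //; lra.
pose s := Num.min t (Num.min qa qb).
have [s1 s2 s3 s4] : [/\ s <= d1, s <= d2, s <= d3 & s <= d4].
  by rewrite !ge_min !lexx !orbT.
have [s5 s6] : s <= qa /\ s <= qb by rewrite !ge_min !lexx !orbT.
have s0 : 0 < s by rewrite !lt_min d10 d20 d30 d40 qa0 qb0.
exists (`|ln s|) => u; have := ler_norm (- ln s); rewrite normrN => ls.
have ls0 := normr_ge0 (ln s).
have /andP[x0 x1] := hexp_itv u; have /andP[f0 f1] := fI _ (hexp_itv u).
split=> hu.
- have u0 : u <= 0 by lra.
  have xE : hexp u = expR u / 2 by rewrite /hexp u0.
  have us : expR u < s by rewrite -[ltRHS]lnK ?posrE // ltr_expR; lra.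
  set x := hexp u in x0 x1 f0 f1 xE *.
  have := H1 x; have := H2 x; rewrite /ball_ /= (CI_0 fCI) !subr0 !sub0r !normrN (gtr0_norm x0).
  move=> /(_ (ltac:(lra)) x0) h2 /(_ (ltac:(lra)) x0) h1.
  have fx : f x <= 2^-1.
    move: h1; rewrite ltr_norml => /andP[h1 _].
    have : f x / x < a + 1 by lra.
    rewrite ltr_pdivrMr // => fx.
    have xq : x <= qa / 2 by lra.
    have a10 : 0 <= a + 1 by lra.
    have := ler_wpM2l a10 xq.
    by rewrite mulrA qaE; lra.
  have -> : fhat f u - u - ln a = ln (f x / x) - ln a.
    have : expR u <= 1 by rewrite -expR0 ler_expR.
    move=> e1; have x2 : x <= 2^-1 by lra.
    rewrite -[in X in _ - X - _](hexpK u) /fhat /hlog -/x fx x2.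
    by rewrite ln_div ?posrE //; ring.
  by rewrite distrC.
- have u0 : 0 < u by lra.
  have xE : 1 - hexp u = expR (- u) / 2.
    by rewrite /hexp leNgt u0 /=; ring.
  have us : expR (- u) < s by rewrite -[ltRHS]lnK ?posrE // ltr_expR; lra.
  have e0 := expR_gt0 (- u).
  set x := hexp u in x0 x1 f0 f1 xE *.
  have := H3 x; have := H4 x; rewrite /ball_ /= (CI_1 fCI) !(@gtr0_norm _ (1 - x)) ?subr_gt0 //.
  have -> : (f x - 1) / (x - 1) = (1 - f x) / (1 - x).
    by rewrite -mulrNN -invrN !opprB.
  move=> /(_ (ltac:(lra)) x1) h2 /(_ (ltac:(lra)) x1) h1.
  have x1' : 0 < 1 - x by lra.
  have f1' : 0 < 1 - f x by lra.
  have fx : 1 - f x < 2^-1.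
    move: h1; rewrite ltr_norml => /andP[h1 _].
    have : (1 - f x) / (1 - x) < b + 1 by lra.
    rewrite ltr_pdivrMr // => fx.
    have xq : 1 - x <= qb / 2 by lra.
    have b10 : 0 <= b + 1 by lra.
    have := ler_wpM2l b10 xq.
    by rewrite mulrA qbE; lra.
  have -> : fhat f u - u - - ln b = - (ln ((1 - f x) / (1 - x)) - ln b).
    have : expR (- u) < 1 by rewrite -expR0 ltr_expR; lra.
    move=> e1; have x2 : 2^-1 < x by lra.
    have fx2 : 2^-1 < f x by lra.
    rewrite -[in X in _ - X - _](hexpK u) /fhat /hlog -/x !leNgt x2 fx2 /=.
    by rewrite ln_div ?posrE //; ring.
  by rewrite normrN distrC.
Qed.

End interval_to_line.

(** * From maps and measures on the line back to the interval *)

Section line_to_interval.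
Context {R : realType}.
Local Notation RT := (measurableTypeR R).
Implicit Types g : R -> R.

(** The identity outside the open interval makes this an increasing bijection of the whole line, so
    that continuity at 0 and 1 needs no separate argument. *)
Definition toI g (x : R) : R := if 0 < x < 1 then hexp (g (hlog x)) else x.

Lemma toI_hexp g u : toI g (hexp u) = hexp (g u).
Proof. by rewrite /toI hexp_itv hexpK. Qed.

Lemma toI_itv g x : (0 < toI g x < 1) = (0 < x < 1).
Proof. by rewrite /toI; case: ifP => // _; rewrite hexp_itv. Qed.

Lemma toI_incbij g g' : incbij g g' -> incbij (toI g) (toI g').
Proof.
move=> gg'; have g_lt := incbij_mono_lt gg'; have [_ gK g'K] := gg'.
have toIK h h' : cancel h h' -> cancel (toI h) (toI h').
  move=> hK x; case x01 : (0 < x < 1).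
    by rewrite /toI x01 hexp_itv hexpK hK hlogK.
  by rewrite /toI !x01.
split; [|exact: toIK|exact: toIK] => x y xy; rewrite /toI.
case: ifP => x01; case: ifP => y01 //.
- by rewrite hexp_mono_lt g_lt hlog_lt.
- have /andP[_ h] := hexp_itv (g (hlog x)); apply: lt_le_trans h _.
  by move/negbT: y01; rewrite negb_and -!leNgt => /orP[]; lra.
- have /andP[h _] := hexp_itv (g (hlog y)); apply: le_lt_trans h.
  by move/negbT: x01; rewrite negb_and -!leNgt => /orP[]; lra.
Qed.

Lemma toI0 g : toI g 0 = 0.
Proof. by rewrite /toI ltxx. Qed.

Lemma toI1 g : toI g 1 = 1.
Proof. by rewrite /toI ltxx andbF. Qed.

Lemma toI_unitI g g' : incbij g g' -> toI g @` @unitI R `<=` @unitI R.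
Proof.
move=> gg' _ [x + <-]; rewrite /unitI /= !in_itv /= => /andP[x0 x1].
have m := incbij_mono_le (toI_incbij gg').
by have := m 0 x; have := m x 1; rewrite toI0 toI1 x0 x1 => -> ->.
Qed.

Lemma toI_within g g' : incbij g g' -> {within @unitI R, continuous (toI g)}.
Proof.
move=> gg'; apply: continuous_subspaceT => x.
exact: (incbij_continuous (toI_incbij gg')).
Qed.

Lemma toI_homeo g g' : incbij g g' -> homeoI (toI g).
Proof.
move=> gg'; have g'g := incbij_sym gg'; have [_ K K'] := toI_incbij gg'.
exists (toI g'); split.
- by split; [exact: toI_within gg'|exact: toI_within g'g].
- by split; [exact: toI_unitI gg'|exact: toI_unitI g'g].
- by move=> x _; rewrite K.
- by move=> x _; rewrite K'.
Qed.

Lemma expR_near (l e : R) : 0 < e ->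
  exists2 d : R, 0 < d & forall t, `|t - l| < d -> `|expR l - expR t| < e.
Proof.
move=> e0; have /cvgrPdist_lt/(_ _ e0)[d /= d0 H] := @continuous_expR R l.
by exists d => // t tl; apply: H; rewrite /ball_ /= distrC.
Qed.

(** For [x] close to 0, both [u = hlog x] and [g u] are nonpositive, and the difference quotient is
    exactly [expR (g u - u)]. *)
Lemma toI_slope0 g l r : disp g l r -> right_slope (toI g) 0 --> expR l.
Proof.
move=> dg; apply/cvgrPdist_lt => e e0; have [d d0 Hd] := expR_near l e0.
have [K HK] := dg _ d0; pose c := `|K| + `|l| + d.
have := ler_norm K; have := normr_ge0 K; have := ler_norm l.
have := normr_ge0 l => l0 l1 K0 K1.
near=> x; have x0 : 0 < x by near: x; exact: nbhs_right_gt.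
have xc : x < hexp (- c).
  by near: x; apply: nbhs_right_lt; case/andP: (hexp_itv (- c)).
have x01 : 0 < x < 1 by have := hexp_itv (- c); lra.
set u := hlog x; have xE : hexp u = x by rewrite hlogK.
have uc : u < - c by rewrite -hexp_mono_lt xE.
have /(HK u).1 gu : u < - K by rewrite /c in uc; lra.
have := gu; rewrite ltr_norml => /andP[g1 g2].
have guN : g u <= 0 by rewrite /c in uc; lra.
have uN : u <= 0 by rewrite /c in uc; lra.
rewrite toI0 !subr0 -xE toI_hexp /hexp guN uN invf_div mulrA divfK //.
by rewrite -expRN -expRD; exact: Hd.
Unshelve. all: by end_near. Qed.

Lemma toI_slope1 g l r : disp g l r -> left_slope (toI g) 1 --> expR (- r).
Proof.
move=> dg; apply/cvgrPdist_lt => e e0; have [d d0 Hd] := expR_near (- r) e0.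
have [K HK] := dg _ d0; pose c := `|K| + `|r| + d.
have := ler_norm K; have := normr_ge0 K; have := ler_norm (- r); rewrite normrN.
have := normr_ge0 r => l0 l1 K0 K1.
near=> x; have x1 : x < 1 by near: x; exact: nbhs_left_lt.
have xc : hexp c < x.
  by near: x; apply: nbhs_left_gt; case/andP: (hexp_itv c).
have x01 : 0 < x < 1 by have := hexp_itv c; lra.
set u := hlog x; have xE : hexp u = x by rewrite hlogK.
have uc : c < u by rewrite -hexp_mono_lt xE.
have /(HK u).2 gu : K < u by rewrite /c in uc; lra.
have := gu; rewrite ltr_norml => /andP[g1 g2].
have guN : 0 < g u by rewrite /c in uc; lra.
have uN : 0 < u by rewrite /c in uc; lra.
rewrite toI1 -xE toI_hexp /hexp !leNgt guN uN /=.
have -> : (1 - expR (- g u) / 2 - 1) / (1 - expR (- u) / 2 - 1)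
    = expR (- (g u - u)).
  have -> : - (g u - u) = - g u + - - u by ring.
  have E (t : R) : 1 - t / 2 - 1 = - (t / 2) by ring.
  by rewrite expRD (expRN (- u)) !E invrN mulrNN invf_div mulrA divfK.
by apply: Hd; rewrite -opprB normrN (_ : - r - - (g u - u) = g u - u - r) //; ring.
Unshelve. all: by end_near. Qed.

Lemma toI_deriv0 g l r : disp g l r -> derivI0 (toI g) = expR l.
Proof. by move=> /toI_slope0 h; apply: cvg_lim h. Qed.

Lemma toI_deriv1 g l r : disp g l r -> derivI1 (toI g) = expR (- r).
Proof. by move=> /toI_slope1 h; apply: cvg_lim h. Qed.

Lemma toI_CI g g' l r : incbij g g' -> disp g l r -> isCI (toI g).
Proof.
move=> gg' dg; have g'g := incbij_sym gg'; have [_ K K'] := toI_incbij gg'.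
split.
- exact: toI_within gg'.
- apply/seteqP; split; first exact: toI_unitI gg'.
  move=> y yI; exists (toI g' y); last exact: K'.
  by apply: (toI_unitI g'g); exists y.
- exact: toI0.
- exact: toI1.
- by move=> _ [x + <-]; rewrite /unitIo /= !in_itv /= toI_itv.
- by apply/cvg_ex; exists (expR l); exact: toI_slope0 dg.
- by rewrite (toI_deriv0 dg) expR_gt0.
- by apply/cvg_ex; exists (expR (- r)); exact: toI_slope1 dg.
- by rewrite (toI_deriv1 dg) expR_gt0.
Qed.

Lemma probI1 (mu : probability RT R) (D A : set RT) : measurable D ->
  measurable A -> mu D = 1%E -> mu (A `&` D) = mu A.
Proof.
move=> mD mA muD; have muDC : mu (~` D) = 0%E.
  by rewrite probability_setC // muD subee.
rewrite -[in RHS](setIT A) -(setvU D) setIUr measureU.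
- rewrite [X in (_ = X + _)%E](_ : _ = 0%E) ?add0e //.
  apply: (@subset_measure0 _ _ _ mu _ (~` D)) => //.
  + by apply: measurableI => //; exact: measurableC.
  + exact: measurableC.
- by apply: measurableI => //; exact: measurableC.
- exact: measurableI.
- by rewrite setIACA setICl setI0.
Qed.

Lemma measurable_preimage h (A : set RT) : measurable_fun setT (h : RT -> RT) ->
  measurable A -> measurable (h @^-1` A).
Proof. by move=> mh mA; rewrite -[X in measurable X]setTI; exact: mh. Qed.

Lemma measurable_hexp : measurable_fun setT (@hexp R : RT -> RT).
Proof.
by apply: nondecreasing_measurable => // x y; rewrite hexp_mono_le.
Qed.

Lemma measurable_hlogR : measurable_fun setT (@hlog R : RT -> RT).
Proof. exact: measurable_hlog. Qed.

Lemma stationary_hlog (f : RDS R) g0 g0' g1 g1' (mu : probability RT R) :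
  map0 f = toI g0 -> map1 f = toI g1 -> incbij g0 g0' -> incbij g1 g1' ->
  stationary f mu ->
  exists2 nu : probability RT R, (forall A, nu A = mu (@hlog R @^-1` A))
    & statR g0 g1 (weight f) nu.
Proof.
move=> f0E f1E gg0 gg1 [mu1 st].
have [nu nuE] := prob_pushforward mu measurable_hlogR.
(* Stationarity tests only subsets of the open interval, and [hlog] is meaningful only there; the
   intersection loses no mass. *)
exists nu => // A mA; pose A' : set RT := @hlog R @^-1` A `&` @unitIo R.
have mIo : measurable (@unitIo R : set RT) by exact: measurable_itv.
have mp B : measurable B -> measurable (@hlog R @^-1` B : set RT).
  by move=> mB; exact: (measurable_preimage measurable_hlogR mB).
have mA' : measurable A' by apply: measurableI => //; exact: mp.
have := st A' mA' (@subIsetr _ _ _).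
have preE g g' : incbij g g' -> mu (@unitI R `&` toI g @^-1` A') = nu (g @^-1` A).
  move=> gg; have mg := mp _ (measurable_preimage (incbij_measurable gg) mA).
  rewrite nuE -(probI1 mIo mg mu1).
  congr (mu _); apply/seteqP; split => x; rewrite /A' /unitI /unitIo /= !in_itv /=.
    by rewrite toI_itv => -[_ []]; rewrite /toI => + x01; rewrite x01 hexpK.
  move=> [Ax x01]; rewrite toI_itv /toI x01 hexpK; split => //.
  by case/andP: x01 => *; rewrite !ltW.
rewrite f0E f1E (preE _ _ gg0) (preE _ _ gg1) nuE => <-.
by rewrite /A' probI1 //; exact: mp.
Qed.

Lemma stationary_hexp (f : RDS R) g0 g1 (nu : probability RT R) :
  map0 f = toI g0 -> map1 f = toI g1 -> statR g0 g1 (weight f) nu ->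
  exists2 mu : probability RT R, (forall A, mu A = nu (@hexp R @^-1` A))
    & stationary f mu.
Proof.
move=> f0E f1E st; have [mu muE] := prob_pushforward nu measurable_hexp.
exists mu => //; split.
  rewrite muE (_ : _ @^-1` _ = setT) ?probability_setT //.
  by apply/seteqP; split => // u _ /=; exact: unitIo_hexp.
move=> A mA AI; rewrite !muE st; last exact: (measurable_preimage measurable_hexp mA).
have preE g : @hexp R @^-1` (@unitI R `&` toI g @^-1` A) = g @^-1` (@hexp R @^-1` A).
  apply/seteqP; split => u /=; rewrite toI_hexp => //.
    by case.
  by split=> //; rewrite /unitI /= in_itv /= !ltW //; case/andP: (hexp_itv u).
by rewrite f0E f1E !preE.
Qed.

Lemma stationary_unique (f : RDS R) g0 g0' g1 g1' (mu nu : probability RT R) :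
  map0 f = toI g0 -> map1 f = toI g1 -> incbij g0 g0' -> incbij g1 g1' ->
  stationary f mu -> stationary f nu ->
  forall A, measurable A -> mu A = nu A.
Proof.
move=> f0E f1E gg0 gg1 smu snu A mA.
have [mu' mu'E smu'] := stationary_hlog f0E f1E gg0 gg1 smu.
have [nu' nu'E snu'] := stationary_hlog f0E f1E gg0 gg1 snu.
have g0lt u : g0 u < u.
  have := map0_lt f (unitIo_hexp u).
  by rewrite f0E toI_hexp hexp_mono_lt.
have eq' := statR_unique gg0 gg1 (weight_in f) g0lt smu' snu'.
have mIo : measurable (@unitIo R : set RT) by exact: measurable_itv.
have mB := measurable_preimage measurable_hexp mA.
have H (m m' : probability RT R) : stationary f m ->
    (forall B, m' B = m (@hlog R @^-1` B)) -> m A = m' (@hexp R @^-1` A).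
  move=> [m1 _] m'E; rewrite m'E -(probI1 mIo mA m1) -[RHS](probI1 mIo _ m1).
    congr (m _); apply/seteqP; split => x; rewrite /unitIo /= in_itv /=.
      by move=> [Ax x01]; rewrite hlogK.
    by move=> [+ x01]; rewrite hlogK.
  exact: (measurable_preimage measurable_hlogR mB).
by rewrite (H _ _ smu mu'E) (H _ _ snu nu'E) eq'.
Qed.

End line_to_interval.

(** * The conjugated system and density *)

Section perturbation.
Context {R : realType}.
Local Notation RT := (measurableTypeR R).

Lemma statR_conj (f0 f1 h h' : R -> R) p (nu nu' : probability RT R) :
  incbij h h' -> (forall A, nu' A = nu (h @^-1` A)) -> statR f0 f1 p nu ->
  statR (h \o f0 \o h') (h \o f1 \o h') p nu'.
Proof.
move=> hh' nu'E st A mA; have [_ hK _] := hh'.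
rewrite !nu'E st; last exact: (measurable_preimage (incbij_measurable hh') mA).
have E f : h @^-1` ((h \o f \o h') @^-1` A) = f @^-1` (h @^-1` A).
  by apply/seteqP; split => x /=; rewrite hK.
by rewrite !E.
Qed.

(** In the coordinate [hlog], with [u = h w], one compares [f (h w)] with [f w] and then [f w] with
    [h (f w)]; each comparison costs at most [d]. *)
Lemma dCI_conj_le (f h h' : R -> R) (d : R) : isCI f -> incbij h h' ->
  (forall u, `|h u - u| <= d) -> (forall u, `|fhat f (h u) - fhat f u| <= d) ->
  (dCI f (toI (h \o fhat f \o h')) <= (2 * d)%:E)%E.
Proof.
move=> fCI [_ hK h'K] hd fd; apply: ge_ereal_sup => _ [x + <-].
rewrite /unitIo /= in_itv /= => x01; rewrite lee_fin /dh.
set u := hlog x; have xE : hexp u = x by rewrite hlogK.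
have -> : hlog (f x) = fhat f u by rewrite /fhat xE.
rewrite -xE toI_hexp hexpK /= -{1}[u]h'K.
set w := h' u; have := fd w; have := hd (fhat f w).
by rewrite !ler_norml; lra.
Qed.

Lemma conj_lt (f h h' : R -> R) : incbij h h' -> (forall u, f u < u) ->
  forall u, (h \o f \o h') u < u.
Proof. by move=> [h_lt _ h'K] fu u /=; rewrite -{2}[u]h'K h_lt. Qed.

Lemma conj_gt (f h h' : R -> R) : incbij h h' -> (forall u, u < f u) ->
  forall u, u < (h \o f \o h') u.
Proof. by move=> [h_lt _ h'K] fu u /=; rewrite -{1}[u]h'K h_lt. Qed.

Lemma toI_lt (g : R -> R) : (forall u, g u < u) ->
  forall x, @unitIo R x -> toI g x < x.
Proof.
move=> gu x; rewrite /unitIo /= in_itv /= => x01.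
by rewrite -{2}(hlogK x01) /toI x01 hexp_mono_lt.
Qed.

Lemma toI_gt (g : R -> R) : (forall u, u < g u) ->
  forall x, @unitIo R x -> x < toI g x.
Proof.
move=> gu x; rewrite /unitIo /= in_itv /= => x01.
by rewrite -{1}(hlogK x01) /toI x01 hexp_mono_lt.
Qed.

Lemma fhat_lt (f : R -> R) : isCI f -> (forall x, @unitIo R x -> f x < x) ->
  forall u, fhat f u < u.
Proof.
move=> fCI flt u; have ui := unitIo_hexp u.
rewrite -[ltRHS]hexpK /fhat hlog_lt ?hexp_itv ?flt //.
have : unitIo (f (hexp u)) by apply: (CI_interior fCI); exists (hexp u).
by rewrite /unitIo /= in_itv.
Qed.

Lemma fhat_gt (f : R -> R) : isCI f -> (forall x, @unitIo R x -> x < f x) ->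
  forall u, u < fhat f u.
Proof.
move=> fCI flt u; have ui := unitIo_hexp u.
rewrite -[ltLHS]hexpK /fhat hlog_lt ?hexp_itv ?flt //.
have : unitIo (f (hexp u)) by apply: (CI_interior fCI); exists (hexp u).
by rewrite /unitIo /= in_itv.
Qed.

Lemma singular_RDS_near (f : RDS R) (eps : R) : 0 < eps ->
  exists g : RDS R, (dm f g < eps%:E)%E /\
    exists mu : probability RT R, unique_stationary g mu /\ singular_measure mu.
Proof.
(* A third rather than a half, because the distance bound [2 * (eps / 3)] must be strictly below
   [eps]. *)
move=> eps0; have d0 : 0 < eps / 3 by rewrite divr_gt0.
have d_lt : 2 * (eps / 3) < eps by lra.
have C0 := map0_CI f; have C1 := map1_CI f.
have [f0' ff0] := fhat_incbij C0 (map0_homeo f).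
have [f1' ff1] := fhat_incbij C1 (map1_homeo f).
have D0 := fhat_disp C0; have D1 := fhat_disp C1.
have L0 := Lambda0_gt0 f; have L1 := Lambda1_gt0 f.
(* The displacement at [+oo] is minus the logarithm of the derivative at 1, so the positive exponent
   there becomes a negative drift. *)
have rneg : weight f * - ln (derivI1 (map0 f)) +
    (1 - weight f) * - ln (derivI1 (map1 f)) < 0.
  by move: L1; rewrite /Lambda1; lra.
have [nu nuS] := statR_exists ff0 ff1 (weight_in f) D0 D1 L0 rneg.
have [h [h' [hh' hd hclose [B [mB nuB lebB]]]]] :=
  singular_perturbation nu d0 ff0 ff1.
have [nu' nu'E] := prob_pushforward nu (incbij_measurable hh').
have hc u : `|h u - u| <= eps / 3 by case: (hclose u).
have h0 u : `|fhat (map0 f) (h u) - fhat (map0 f) u| <= eps / 3.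
  by case: (hclose u).
have h1 u : `|fhat (map1 f) (h u) - fhat (map1 f) u| <= eps / 3.
  by case: (hclose u).
have q0 := dCI_conj_le C0 hh' hc h0; have q1 := dCI_conj_le C1 hh' hc h1.
set g0 := h \o fhat (map0 f) \o h'; set g1 := h \o fhat (map1 f) \o h'.
have gg0 : incbij g0 (h \o f0' \o h').
  exact: incbij_comp (incbij_comp hh' ff0) (incbij_sym hh').
have gg1 : incbij g1 (h \o f1' \o h').
  exact: incbij_comp (incbij_comp hh' ff1) (incbij_sym hh').
have dg0 := disp_conj hh' hd D0; have dg1 := disp_conj hh' hd D1.
(* The endpoint derivatives are unchanged by the conjugation, so both exponents stay positive. *)
have E00 : derivI0 (toI g0) = derivI0 (map0 f).
  by rewrite (toI_deriv0 dg0) lnK // posrE CI_deriv0_gt0.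
have E10 : derivI0 (toI g1) = derivI0 (map1 f).
  by rewrite (toI_deriv0 dg1) lnK // posrE CI_deriv0_gt0.
have E01 : derivI1 (toI g0) = derivI1 (map0 f).
  by rewrite (toI_deriv1 dg0) opprK lnK // posrE CI_deriv1_gt0.
have E11 : derivI1 (toI g1) = derivI1 (map1 f).
  by rewrite (toI_deriv1 dg1) opprK lnK // posrE CI_deriv1_gt0.
have L0' : 0 < Lambda0 (toI g0) (toI g1) (weight f).
  rewrite /Lambda0 E00 E10; exact: L0.
have L1' : 0 < Lambda1 (toI g0) (toI g1) (weight f).
  rewrite /Lambda1 E01 E11; exact: L1.
pose g := MkRDS (toI_CI gg0 dg0) (toI_CI gg1 dg1) (toI_homeo gg0) (toI_homeo gg1)
  (toI_lt (conj_lt hh' (fhat_lt C0 (map0_lt f))))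
  (toI_gt (conj_gt hh' (fhat_gt C1 (map1_gt f)))) (weight_in f) L0' L1'.
exists g; split.
  apply: (@le_lt_trans _ _ (2 * (eps / 3))%:E); last by rewrite lte_fin.
  rewrite /dm ge_max; apply/andP; split.
    by rewrite ge_max; apply/andP; split; [exact: q0|exact: q1].
  by rewrite /= subrr normr0 lee_fin mulr_ge0 // ltW.
have nu'S : statR g0 g1 (weight g) nu' by exact: statR_conj hh' nu'E nuS.
have [mu muE muS] := @stationary_hexp R g g0 g1 nu' erefl erefl nu'S.
exists mu; split.
  split => // m mS.
  exact: (@stationary_unique R g g0 _ g1 _ m mu erefl erefl gg0 gg1 mS muS).
exists (@hlog R @^-1` B `&` @unitIo R); split => //.
- apply: measurableI; last exact: measurable_itv.
  exact: (measurable_preimage measurable_hlogR mB).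
- rewrite muE -nuB -nu'E; congr (nu' _); apply/seteqP; split => u /=.
    by rewrite hexpK => -[].
  by move=> Bu; rewrite hexpK; split=> //; exact: unitIo_hexp.
Qed.

End perturbation.

Theorem corollary4p2 (R : realType) :
  dense [set f : RDS R |
    exists mu : probability (measurableTypeR R) R,
      unique_stationary f mu /\ singular_measure mu].
Proof.
move=> O [f Of] oO; have /nbhs_ballP[eps /= eps0 Oball] := open_nbhs_nbhs (conj oO Of).
have [g [fg gS]] := singular_RDS_near f eps0.
by exists g; split => //; apply: Oball.
Qed.
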